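(* Let $E \subset \mathbb{C}$ be a compact set with $\operatorname{cap}(E) > 0$. Let $M_E$ be the smallest constant $M>0$ such that $$\prod_{k=1}^m \|p_k\|_E \le M^n \,\|p\|_E$$ for every $m \ge 1$ and all algebraic polynomials $p_1,\dots,p_m$ with complex coefficients, where $p(z) = \prod_{k=1}^m p_k(z)$ and $n = \deg p$. Then $$M_E = \frac{\exp\left(\int \log d_E(z)\, d\mu_E(z)\right)}{\operatorname{cap}(E)}.$$
   Context: For a compact set $E\subset\mathbb{C}$, $\|f\|_E = \sup_{z\in E}|f(z)|$. $\operatorname{cap}(E)$ denotes the logarithmic capacity of $E$, and, when $\operatorname{cap}(E)>0$, $\mu_E$ denotes the equilibrium measure of $E$ (in the sense of logarithmic potential theory), a positive unit Borel measure supported on $E$. The function $d_E$ is defined by $d_E(z) = \max_{t\in E}|z-t|$ for $z\in\mathbb{C}$. *)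

(* Defs.v *)
From HB Require Import structures.
From mathcomp Require Import all_boot all_order all_algebra complex.
From mathcomp Require Import all_classical all_reals all_analysis.

Set Implicit Arguments.
Unset Strict Implicit.
Unset Printing Implicit Defensive.

Import Order.TTheory GRing.Theory Num.Theory.
Import numFieldNormedType.Exports.

Local Open Scope classical_set_scope.
Local Open Scope ring_scope.

(* [R[i]] itself carries no topology in the library; its regular module
   [R[i]^o] has the usual topology of the complex plane. *)
Notation Cplane R := (complex R)^o (only parsing).

Definition borelC (R : realType) := g_sigma_algebraType (@open (Cplane R)).

(* The library norm [`|z|] of a complex number is itself an element of
   [R[i]]; [cmod z] is the same modulus as an element of [R]. *)
Definition cmod (R : realType) (z : Cplane R) : R := complex.Re `|z|.

Definition sup_norm (R : realType) (E : set (Cplane R)) (f : Cplane R -> R[i]) : R :=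
  sup [set cmod (f z) | z in E].

(* For a nonempty compact [E] the supremum is attained, i.e. it is the maximum. *)
Definition farthest_dist (R : realType) (E : set (Cplane R)) (z : Cplane R) : R :=
  sup [set cmod (z - t) | t in E].

(* log (1 / |z - t|), with value +oo on the diagonal (as [lne 0 = -oo],
   whereas the real-valued [ln] has [ln 0 = 0]). *)
Definition log_kernel (R : realType) (z t : Cplane R) : \bar R :=
  (- lne (cmod (z - t))%:E)%E.

Definition log_energy (R : realType) (mu : probability (borelC R) R) : \bar R :=
  (\int[mu]_z \int[mu]_t log_kernel z t)%E.

Definition carried_by (R : realType) (E : set (Cplane R))
    (mu : probability (borelC R) R) : Prop :=
  mu (~` E : set (borelC R)) = 0%E.

Definition robin_constant (R : realType) (E : set (Cplane R)) : \bar R :=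
  ereal_inf [set log_energy mu | mu in carried_by E].

(* exp (- V) where V is the Robin constant; it is 0 when V = +oo.  For compact
   [E] one always has V > -oo, so that [fine] loses nothing. *)
Definition log_capacity (R : realType) (E : set (Cplane R)) : R :=
  fine (expeR (- robin_constant E)).

(* When [log_capacity E > 0] there is exactly one such measure (Frostman). *)
Definition is_equilibrium_measure (R : realType) (E : set (Cplane R))
    (mu : probability (borelC R) R) : Prop :=
  carried_by E mu /\ log_energy mu = robin_constant E.

(* The degree of p is [(size p).-1]; the convention [deg 0 = 0] is immaterial
   here, since the inequality reads 0 <= 0 as soon as some [p k] is 0. *)
Definition product_inequality (R : realType) (E : set (Cplane R)) (M : R) : Prop :=
  forall (m : nat) (p : 'I_m -> {poly R[i]}), (1 <= m)%N ->
    let q := \prod_(k < m) p k in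
    \prod_(k < m) sup_norm E (fun z => (p k).[z])
      <= M ^+ (size q).-1 * sup_norm E (fun z => q.[z]).

Definition is_smallest (R : realType) (P : R -> Prop) (x : R) : Prop :=
  P x /\ forall y, P y -> x <= y.

(* Main.v *)
(* Let V be the Robin constant, k(z, t) = log (1 / |z - t|) and f = log d_E.

   Any sequence of finite subsets of E has a limit measure on E, so n distinct
   points of E have mean mutual energy at least V - o(1).  The first variation
   of the energy shows that the potential of mu_E is at most V on a set K of
   full measure.  Hence points of K that nearly minimize
   sum_(i <> j) k(x_i, x_j) + 2 a n sum_i f(x_i), with a > 0 small, have all
   their sums sum_(j <> i) k(x_i, x_j) at most n (V + o(1)) and, by averaging
   over mu_E, a mean of f at most the integral of f plus o(1).

   Upper bound: let |p_k| be maximal on E at t_k, let z_j be the roots of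
   p = prod p_k, each one attached to the t_k of its factor, and let q be a
   combination of the (z - t_k)^s that is not small at the z_j.  Up to constants,
   the resultant of p and q is prod_j q(z_j), which is at least
   prod_j |z_j - t_k|^s, and it is also prod_w p(w) over the roots w of q.
   Lagrange interpolation of a power of p at the points x_i bounds each p(w) by
   |p|_E and prod_i max(r, |w - x_i|), and by Landau's inequality the product of
   the latter over w is at most the maximum of |q| near x_i, hence about
   d_E(x_i)^s.  Let s, then the number of points, tend to infinity.

   Lower bound: points of E nearly minimizing the same energy with a < 0 are the
   roots of polynomials of small norm on E for which the mean of f is almost the
   integral of f; apply the inequality to their linear factors. *)

Require Import Defs.
From HB Require Import structures.
From mathcomp Require Import all_boot all_order all_algebra complex.
From mathcomp Require Import all_classical all_reals all_analysis.
From mathcomp Require Import cyclic separable cyclotomic measurable_realfun.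
From mathcomp Require Import ring lra zify.

Set Implicit Arguments.
Unset Strict Implicit.
Unset Printing Implicit Defensive.

Import Order.TTheory GRing.Theory Num.Theory.
Import numFieldNormedType.Exports.

Local Open Scope classical_set_scope.
Local Open Scope ring_scope.

(** * The complex modulus and compact plane sets *)

(** Almost minimal energy alone does not control the mean of f over the points: that would require
    weak convergence to [mu_E], hence uniqueness of the minimizer. The tilt by a replaces both.
    Summed over i, the bound on the tilted sums reads energy + a n sum_i f(x_i) <= n^2 (V + a F) up
    to lower order, with F the integral of f; every configuration has energy at least n^2 (V -
    o(1)), so dividing by a, which is fixed before n, isolates the mean of f.

    The combination q stands in for a measure whose logarithmic potential represents log d_E: (log
    |q|) / s is at most max_k log |w - t_k| up to O(1/s) everywhere, matches it from below at the
    z_j, and the roots of q carry the corresponding Riesz mass. The symmetry of the resultant is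
    then Fubini's theorem for the logarithmic kernel. Interpolation is what trades the values of p
    at the roots of q, which may lie far from E, for values of p on E. *)

Section cmod_theory.
Context {R : realType}.
Implicit Types z w t : Cplane R.

Lemma cmodE z : (cmod z)%:C%C = `|z|.
Proof. by []. Qed.

Lemma cmod_ge0 z : 0 <= cmod z.
Proof. by rewrite -ler0c cmodE. Qed.

Lemma cmod_eq0 z : (cmod z == 0) = (z == 0).
Proof.
rewrite -(inj_eq (@complexI R)) cmodE.
exact: normr_eq0.
Qed.

Lemma cmod0 : cmod (0 : R[i]) = 0.
Proof. by apply/eqP; rewrite cmod_eq0. Qed.

Lemma cmod1 : cmod (1 : R[i]) = 1.
Proof. by apply: complexI; rewrite cmodE normr1. Qed.

Lemma cmodN z : cmod (- z) = cmod z.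
Proof. by apply: complexI; rewrite !cmodE normrN. Qed.

Lemma cmodB z w : cmod (z - w) = cmod (w - z).
Proof. by rewrite -cmodN opprB. Qed.

Lemma cmodM (z w : R[i]) : cmod (z * w) = cmod z * cmod w.
Proof. by apply: complexI; rewrite rmorphM/= !cmodE; exact: normrM. Qed.

Lemma cmodX (z : R[i]) n : cmod (z ^+ n) = cmod z ^+ n.
Proof. by apply: complexI; rewrite rmorphXn/= !cmodE; exact: normrX. Qed.

Lemma cmod_prod (I : Type) (r : seq I) (P : pred I) (F : I -> R[i]) :
  cmod (\prod_(i <- r | P i) F i) = \prod_(i <- r | P i) cmod (F i).
Proof.
by elim/big_rec2: _ => [|i y1 y2 _ <-]; [exact: cmod1|exact: cmodM].
Qed.

Lemma cmodV (z : R[i]) : cmod z^-1 = (cmod z)^-1.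
Proof. by apply: complexI; rewrite fmorphV/= !cmodE; exact: normfV. Qed.

Lemma cmodD z w : cmod (z + w) <= cmod z + cmod w.
Proof. by rewrite -lecR rmorphD/= !cmodE; exact: ler_normD. Qed.

Lemma cmod_triangle t z w : cmod (z - w) <= cmod (z - t) + cmod (t - w).
Proof. by rewrite (le_trans _ (cmodD _ _))// addrA subrK. Qed.

Lemma cmod_sum (I : Type) (r : seq I) (P : pred I) (F : I -> R[i]) :
  cmod (\sum_(i <- r | P i) F i) <= \sum_(i <- r | P i) cmod (F i).
Proof.
elim/big_rec2: _ => [|i y1 y2 _ h]; first by rewrite cmod0.
by rewrite (le_trans (cmodD _ _))// lerD2l.
Qed.

Lemma cmod_real (x : R) : cmod (x%:C%C : R[i]) = `|x|.
Proof.
by rewrite /cmod normc_def/= expr0n/= addr0 sqrtr_sqr.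
Qed.

Lemma cmod_nat n : cmod (n%:R : R[i]) = n%:R.
Proof.
have -> : (n%:R : R[i]) = (n%:R)%:C%C by rewrite rmorph_nat.
by rewrite cmod_real ger0_norm.
Qed.

Lemma cmodJ (z : R[i]) : cmod (z^*)%C = cmod z.
Proof. by apply: complexI; rewrite !cmodE; exact: normcJ. Qed.

Lemma nbhs_cmodP z (A : set (Cplane R)) :
  nbhs z A <-> exists2 e : R, 0 < e & forall w, cmod (z - w) < e -> A w.
Proof.
rewrite -nbhs_ballE; split.
- case=> e /= e0; rewrite -ball_normE => eA.
  have er : e = (complex.Re e)%:C%C by rewrite RRe_real// ger0_real// ltW.
  exists (complex.Re e); first by rewrite -ltcR -er.
  by move=> w zw; apply: eA => /=; rewrite -cmodE er ltcR.
- case=> e e0 eA; exists e%:C%C => /=; first by rewrite ltcR.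
  by rewrite -ball_normE => w /=; rewrite -cmodE ltcR; exact: eA.
Qed.

End cmod_theory.

Section compact_plane.
Context {R : realType}.
Variable E : set (Cplane R).
Hypothesis cE : compact E.

Lemma compact_cluster (x : nat -> Cplane R) : (forall n, E (x n)) ->
  exists2 z, E z & forall N (e : R), 0 < e -> exists2 n, (N <= n)%N & cmod (x n - z) < e.
Proof.
move=> xE; have [|z [Ez clz]] := cE (F := x @ \oo) _ _.
  by exists 0%N => // n _; exact: xE.
exists z => // N e e0.
have h1 : (x @ \oo) (x @` [set n | (N <= n)%N]).
  by exists N => // n /= nN; exists n.
have h2 : nbhs z [set w | cmod (w - z) < e].
  by apply/nbhs_cmodP; exists e => // w /=; rewrite cmodB.
have [_ [[n /= nN <-] /= h]] := clz _ _ h1 h2.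
by exists n.
Qed.

(** If no finite net existed, greedy choice would give an infinite sequence of points at mutual
    distance at least [e], which cannot cluster. *)
Lemma compact_net (e : R) : 0 < e ->
  exists s : seq (Cplane R), (forall c, c \in s -> E c) /\
    forall z, E z -> exists2 c, c \in s & cmod (z - c) < e.
Proof.
move=> e0; apply: contrapT => hs.
have step (s : seq (Cplane R)) : exists z, (forall c, c \in s -> E c) ->
    E z /\ forall c, c \in s -> e <= cmod (z - c).
  have [sE|nsE] := pselect (forall c, c \in s -> E c); last by exists 0.
  apply: contrapT => hz; apply: hs; exists s; split=> // z Ez.
  apply: contrapT => hc; apply: hz; exists z => _; split=> // c cs.
  by rewrite leNgt; apply/negP => h; apply: hc; exists c.
have [f fP] := choice step.
pose s := fix s n := if n is n.+1 then f (s n) :: s n else [::].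
have sE n : forall c, c \in s n -> E c.
  elim: n => //= n ih c; rewrite in_cons => /orP[/eqP->|]; last exact: ih.
  exact: (fP _ ih).1.
pose x n := f (s n).
have xs m n : (m < n)%N -> x m \in s n.
  elim: n => // n ih; rewrite ltnS leq_eqVlt => /orP[/eqP->|/ih h].
    by rewrite /= mem_head.
  by rewrite /= in_cons h orbT.
have xd m n : (m < n)%N -> e <= cmod (x n - x m).
  by move=> mn; exact: (fP _ (@sE n)).2 _ (xs _ _ mn).
have [z Ez hz] := compact_cluster (fun n => (fP _ (@sE n)).1).
have [m _ hm] := hz 0%N (e / 2) ltac:(lra).
have [n mn hn] := hz m.+1 (e / 2) ltac:(lra).
have := xd _ _ mn; rewrite leNgt => /negP; apply.
have := cmod_triangle z (x n) (x m); rewrite (cmodB z).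
rewrite -/(x n) in hn; rewrite -/(x m) in hm; lra.
Qed.

Lemma compact_diameter : exists2 D : R, 1 <= D &
  forall z t, E z -> E t -> cmod (z - t) <= D.
Proof.
have [s [sE sP]] := compact_net (e := 1) ltr01.
pose D := \sum_(c <- s) \sum_(d <- s) cmod (c - d) + 2.
have D2 : 0 <= \sum_(c <- s) \sum_(d <- s) cmod (c - d).
  by apply: sumr_ge0 => c _; apply: sumr_ge0 => d _; exact: cmod_ge0.
exists D => [|z t Ez Et]; first by rewrite /D; lra.
have [c cs zc] := sP _ Ez; have [d ds td] := sP _ Et.
have cd : cmod (c - d) <= \sum_(c <- s) \sum_(d <- s) cmod (c - d).
  rewrite (big_rem c)//= (big_rem d)//= -addrA lerDl addr_ge0//.
    by apply: sumr_ge0 => ? _; exact: cmod_ge0.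
  by apply: sumr_ge0 => ? _; apply: sumr_ge0 => ? _; exact: cmod_ge0.
have := cmod_triangle c z t; have := cmod_triangle d c t.
rewrite (cmodB d t) /D; lra.
Qed.

Lemma compact_closedC : closed E.
Proof.
apply: compact_closed => //; exact: norm_hausdorff.
Qed.

Lemma measurable_compactC : measurable (E : set (borelC R)).
Proof.
rewrite -(setCK E); apply: measurableC.
by apply: sub_sigma_algebra; rewrite openC; exact: compact_closedC.
Qed.

(* A sequence whose values approach the supremum clusters at a maximum point. *)
Lemma compact_max (g : Cplane R -> R) : E !=set0 ->
  (forall z, forall e : R, 0 < e -> exists2 d : R, 0 < d &
     forall w, cmod (w - z) < d -> `|g w - g z| < e) ->
  exists2 z, E z & forall w, E w -> g w <= g z.
Proof.
move=> [z0 Ez0] gc.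
have bd : has_ubound [set g z | z in E].
  apply: contrapT => nb.
  have step (n : nat) : exists z, E z /\ n%:R < g z.
    apply: contrapT => h; apply: nb; exists n%:R => _ [z Ez <-].
    by rewrite leNgt; apply/negP => hz; apply: h; exists z.
  have [x xP] := choice step.
  have [z Ez hz] := compact_cluster (fun n => (xP n).1).
  have [d d0 gd] := gc z 1 ltr01.
  pose N := (Num.truncn (g z + 1)).+1.
  have [n Nn nz] := hz N d d0.
  have := gd _ nz; have := (xP n).2.
  have : g z + 1 < n%:R by apply: lt_le_trans (truncnS_gt _) _; rewrite ler_nat.
  rewrite ltr_norml => h1 h2 /andP[_ h3]; lra.
pose S := sup [set g z | z in E].
have gS w : E w -> g w <= S by move=> Ew; apply: ub_le_sup => //; exists w.
have step (n : nat) : exists z, E z /\ S - n.+1%:R^-1 < g z.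
  have hs : has_sup [set g z | z in E] by split => //; exists (g z0); exists z0.
  have n0 : 0 < n.+1%:R^-1 :> R by rewrite invr_gt0.
  have [_ [z Ez <-] h] := sup_adherent n0 hs.
  by exists z.
have [x xP] := choice step.
have [z Ez hz] := compact_cluster (fun n => (xP n).1).
exists z => // w Ew; apply: (le_trans (gS _ Ew)).
apply/ler_addgt0Pr => e e0.
have [d d0 gd] := gc z (e / 2) ltac:(lra).
pose N := (Num.truncn (2 / e)).+1.
have [n Nn nz] := hz N d d0.
have := gd _ nz; have := (xP n).2.
have : n.+1%:R^-1 <= e / 2.
  rewrite -[e / 2]invrK lef_pV2 ?posrE ?invr_gt0 ?divr_gt0//.
  rewrite invf_div; apply: ltW; apply: lt_le_trans (truncnS_gt _) _.
  by rewrite ler_nat; exact: leq_trans Nn _.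
rewrite ltr_norml; move: n.+1%:R^-1 S {gS bd step xP hz} => v S h1 h2 /andP[_ h3].
lra.
Qed.

End compact_plane.

(** * Polynomial inequalities *)

Section avoiding.
Context {R : realType}.

Lemma cmod_natB_ge1 (m n : nat) : m != n -> 1 <= cmod (m%:R - n%:R : R[i]).
Proof.
wlog nm : m n / (n < m)%N => [hw mn|_].
  have [h|h|h] := ltngtP n m; first exact: hw.
    by rewrite cmodB; apply: hw; rewrite // eq_sym.
  by rewrite h eqxx in mn.
rewrite -natrB; last exact: ltnW.
by rewrite cmod_nat ler1n subn_gt0.
Qed.

(** Pigeonhole: if two values of [y] were bad for the same [j], subtraction would give |y - y'| |a
    j| < |a j|, although distinct naturals differ by at least 1. So each of the [n] indices spoils
    at most one of [n.+1] values. *)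
Lemma avoid_small (n : nat) (a b : 'I_n -> R[i]) :
  exists2 y : nat, (y <= n)%N & forall j, cmod (a j) / 2 <= cmod (b j + y%:R * a j).
Proof.
apply: contrapT => hn.
have bad (y : 'I_n.+1) : exists j, cmod (b j + y%:R * a j) < cmod (a j) / 2.
  apply: contrapT => hy; apply: hn; exists y; first by rewrite -ltnS.
  by move=> j; rewrite leNgt; apply/negP => h; apply: hy; exists j.
have [f fP] := choice bad.
have finj : injective f.
  move=> y z fyz; apply: contrapT => /eqP yz.
  have := fP y; have := fP z; rewrite -fyz; set j := f y => hz hy.
  have : cmod ((y%:R - z%:R) * a j) < cmod (a j).
    have -> : (y%:R - z%:R) * a j = (b j + y%:R * a j) - (b j + z%:R * a j) by ring.
    by apply: le_lt_trans (cmodD _ _) _; rewrite cmodN; lra.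
  rewrite cmodM ltNge => /negP; apply; apply: ler_peMl; first exact: cmod_ge0.
  exact: cmod_natB_ge1.
have := leq_card f finj; rewrite !card_ord ltnn; exact.
Qed.

(** Applied to s-th powers, it makes one polynomial large at all prescribed points at once, with a
    loss independent of s. The coefficients are naturals so that the leading terms of these powers
    cannot cancel. *)
Lemma nonvanishing_combination (n m : nat) (a : 'I_n -> nat -> R[i]) :
  exists x : nat -> nat, (forall k, (x k <= n)%N) /\
    forall j k, (k < m)%N ->
      (4 * n.+1%:R) ^- m * cmod (a j k) <= cmod (\sum_(i < m) (x i)%:R * a j i).
Proof.
elim: m => [|m [x [xn xP]]]; first by exists (fun=> 0%N).
have [y yn yP] := avoid_small (fun j => a j m) (fun j => \sum_(i < m) (x i)%:R * a j i).
pose x' k := if k == m then y else x k.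
exists x'; split=> [k|j k]; first by rewrite /x'; case: ifP.
have x'E : \sum_(i < m.+1) (x' i)%:R * a j i =
    \sum_(i < m) (x i)%:R * a j i + y%:R * a j m.
  rewrite big_ord_recr/= /x' eqxx; congr (_ + _).
  by apply: eq_bigr => i _; rewrite ltn_eqF.
rewrite x'E; set b := \sum_(i < m) _.
have n1 : 1 <= n.+1%:R :> R by rewrite ler1n.
have c0 : 0 < 4 * n.+1%:R :> R by lra.
have h1 := yP j; rewrite -/b in h1.
(* By [h1] the new term is at most 2 y times the new sum, so removing it costs a factor below
   [4 * n.+1%:R]; this is lost once per added term. *)
have h2 : cmod b <= (4 * n.+1%:R) * cmod (b + y%:R * a j m).
  have h3 : cmod b <= cmod (b + y%:R * a j m) + y%:R * cmod (a j m).
    rewrite -cmod_nat -cmodM -cmodN.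
    have -> : - b = - (b + y%:R * a j m) + y%:R * a j m by ring.
    by rewrite (le_trans (cmodD _ _))// cmodN.
  have yn' : y%:R <= n.+1%:R :> R by rewrite ler_nat leqW.
  have := cmod_ge0 (a j m); have := cmod_ge0 (b + y%:R * a j m).
  move: h1 h3 yn' n1; move: n.+1%:R => N; nra.
have a0 := cmod_ge0 (b + y%:R * a j m).
rewrite ltnS leq_eqVlt => /orP[/eqP->|km].
- rewrite exprS invfM -mulrA ler_pdivrMl// (@le_trans _ _ (cmod (a j m)))//.
    rewrite ler_piMl ?cmod_ge0// invf_le1 ?exprn_gt0// exprn_ege1//; lra.
  move: h1 n1 a0; move: n.+1%:R => N; nra.
- by rewrite exprS invfM -mulrA ler_pdivrMl// (le_trans (xP _ _ km)).
Qed.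

End avoiding.

Lemma closed_prim_root_exists (F : numClosedFieldType) n :
  (0 < n)%N -> exists z : F, n.-primitive_root z.
Proof.
pose p : {poly F} := 'X^n - 1; have [r Dp] := closed_field_poly_normal p.
move=> n_gt0; rewrite (monicP _) ?monicXnsubC// scale1r in Dp.
have rn1: all n.-unity_root r by apply/allP=> z; rewrite -root_prod_XsubC -Dp.
have sz_r: (n < (size r).+1)%N.
  by rewrite -(size_prod_XsubC r id) -Dp size_XnsubC.
have [|z] := hasP (has_prim_root n_gt0 rn1 _ sz_r); last by exists z.
by rewrite -separable_prod_XsubC -Dp separable_Xn_sub_1// pnatr_eq0 -lt0n.
Qed.

(** * Maximum principle and Landau's inequality on circles *)

Section Landau.
Context {R : realType}.

Lemma sum_prim_root (F : fieldType) n (z : F) k : n.-primitive_root z ->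
  (0 < k < n)%N -> \sum_(i < n) (z ^+ i) ^+ k = 0.
Proof.
move=> pz /andP[k0 kn].
have zk1 : z ^+ k != 1.
  by rewrite -(expr0 z) (eq_prim_root_expr pz) mod0n modn_small// -lt0n.
apply/eqP; rewrite -(inj_eq (mulfI (_ : z ^+ k - 1 != 0))) ?subr_eq0// mulr0.
rewrite (eq_bigr (fun i : 'I_n => (z ^+ k) ^+ i)); last first.
  by move=> i _; rewrite exprAC.
by rewrite -subrX1 exprAC (prim_expr_order pz) expr1n subrr.
Qed.

(** Averaging over more roots of unity than [G] has coefficients cancels all nonconstant terms, so
    the mean of the values on the circle is exactly [G.[0]]. *)
Lemma max_circle (G : {poly R[i]}) (r : R) : 0 < r ->
  exists z : R[i], cmod z = r /\ cmod G.[0] <= cmod G.[z].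
Proof.
move=> r0; have [w pw] := @closed_prim_root_exists R[i] (size G).+1 isT.
have w1 : cmod w = 1.
  apply/eqP; rewrite -(@pexpr_eq1 _ _ (size G).+1)//; last exact: cmod_ge0.
  by rewrite -cmodX (prim_expr_order pw) cmod1.
apply: contrapT => hn.
have small (i : 'I_(size G).+1) : cmod G.[r%:C%C * w ^+ i] < cmod G.[0].
  rewrite ltNge; apply/negP => h; apply: hn; exists (r%:C%C * w ^+ i); split=> //.
  by rewrite cmodM cmodX w1 expr1n mulr1 cmod_real gtr0_norm.
have avg : \sum_(i < (size G).+1) G.[r%:C%C * w ^+ i] = (size G).+1%:R * G.[0].
  under eq_bigr do rewrite (horner_coef_wide _ (leqnSn _)).
  rewrite exchange_big/= big_ord_recl/= [X in _ + X]big1 => [|k _].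
    rewrite addr0 (eq_bigr (fun=> G`_0)) => [|i _]; last by rewrite expr0 mulr1.
    by rewrite sumr_const card_ord horner_coef0 mulr_natl.
  under eq_bigr do rewrite exprMn mulrA.
  rewrite -mulr_sumr sum_prim_root ?mulr0//.
  by rewrite /= /bump leq0n add1n ltnS.
have : cmod (\sum_(i < (size G).+1) G.[r%:C%C * w ^+ i]) < (size G).+1%:R * cmod G.[0].
  apply: le_lt_trans (cmod_sum _ _ _) _.
  rewrite mulr_natl -[X in _ *+ X]card_ord -sumr_const.
  rewrite !big_ord_recl; apply: ltr_leD; first exact: small.
  by apply: ler_sum => i _; exact: ltW.
by rewrite avg cmodM cmod_nat ltxx.
Qed.

(* Landau's inequality: reflecting the roots of modulus < r in the circle of
   radius r does not change the modulus of the polynomial on that circle. *)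
Lemma prod_max_le_circle (s : seq R[i]) (t : R[i]) (r : R) : 0 < r ->
  exists t' : R[i], cmod (t' - t) = r /\
    \prod_(w <- s) Num.max r (cmod (w - t)) <= \prod_(w <- s) cmod (t' - w).
Proof.
move=> r0.
(* At 0 the modulus of [g w] is max(r, |w - t|); on |z| = r it equals |z - (w - t)|, because there
   the conjugate of z is r^2 / z. *)
pose g w : {poly R[i]} := if cmod (w - t) < r
  then r%:C%C%:P - ((w - t)^*%C / r%:C%C) *: 'X else 'X - (w - t)%:P.
have [z [zr]] := max_circle (\prod_(w <- s) g w) r0.
rewrite !horner_prod !cmod_prod => h; exists (z + t); rewrite addrK; split=> //.
rewrite (eq_bigr (fun w => cmod (g w).[0])) => [|w _].
  rewrite (le_trans h)// le_eqVlt; apply/orP; left; apply/eqP.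
  apply: eq_bigr => w _; rewrite /g; case: ifP => _; rewrite !hornerE.
    have zz : z * z^*%C = (r%:C%C) ^+ 2 by rewrite -sqr_normc -cmodE zr.
    have rn0 : r%:C%C != 0 :> R[i].
      by rewrite eq_complex/= eqxx andbT gt_eqF.
    have -> : r%:C%C - (w - t)^*%C / r%:C%C * z = z / r%:C%C * (z - (w - t))^*%C.
      rewrite (rmorphB conjc z)/= mulrBr [z / _ * z^*%C]mulrAC zz expr2 mulfK//.
      by congr (_ - _); rewrite mulrAC [RHS]mulrC mulrA.
    rewrite cmodM cmodJ cmodM cmodV cmod_real gtr0_norm// zr divff ?gt_eqF// mul1r.
    by congr cmod; rewrite opprB addrA addrAC.
  by congr cmod; ring.
rewrite /g; case: ifPn => [wr|]; rewrite !hornerE.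
  by rewrite subr0 cmod_real gtr0_norm//; apply/max_idPl/ltW.
by rewrite -leNgt => wr; rewrite cmodN; apply/max_idPr.
Qed.

End Landau.

(** * Lagrange interpolation and the resultant estimate *)

Section interpolation.
Context {R : realType}.

Lemma lagrange_interpolation (F : fieldType) (N : nat) (x : 'I_N -> F)
    (P : {poly F}) : injective x -> (size P <= N)%N ->
  P = \sum_(i < N) (P.[x i] / \prod_(k < N | k != i) (x i - x k)) *:
        \prod_(k < N | k != i) ('X - (x k)%:P).
Proof.
move=> xi sP; apply/eqP; rewrite -subr_eq0; apply/eqP.
apply: (@roots_geq_poly_eq0 _ _ [seq x i | i <- enum 'I_N]).
- apply/allP => _ /mapP[j _ ->]; rewrite rootE !hornerE horner_sum.
  rewrite (bigD1 j)//= [X in _ - (_ + X)]big1 => [|i ij].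
    rewrite addr0 !hornerE horner_prod.
    under [X in _ - _ * X]eq_bigr do rewrite !hornerE.
    rewrite divfK ?subrr//; apply/prodf_neq0 => k kj.
    by rewrite subr_eq0 (inj_eq xi) eq_sym.
  rewrite hornerZ horner_prod [X in _ * X](bigD1 j) 1?eq_sym//=.
  by rewrite hornerXsubC subrr mul0r mulr0.
- by rewrite map_inj_uniq// enum_uniq.
- rewrite size_map size_enum_ord (leq_trans (size_polyD _ _))// geq_max sP.
  rewrite size_polyN (leq_trans (size_sum _ _ _))//; apply/bigmax_leqP => i _.
  rewrite (leq_trans (size_scale_leq _ _))// (leq_trans (size_prod_leq _ _))//.
  under eq_bigr do rewrite size_XsubC.
  rewrite sum_nat_const cardC1 card_ord; have := ltn_ord i; lia.
Qed.

(** Each Lagrange numerator lacks its own factor. Once all factors are raised to at least [r], the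
    full product divided by [r] bounds every numerator alike. *)
Lemma lagrange_bound (N : nat) (x : 'I_N.+1 -> R[i]) (P : {poly R[i]})
    (w : R[i]) (S e r : R) :
  injective x -> (size P <= N.+1)%N -> 0 < r -> 0 < e ->
  (forall i, cmod P.[x i] <= S) ->
  (forall i, e <= \prod_(k < N.+1 | k != i) cmod (x i - x k)) ->
  cmod P.[w] <= S * (N.+1%:R / (e * r)) * \prod_(k < N.+1) Num.max r (cmod (w - x k)).
Proof.
move=> xi sP r0 e0 PS ex.
rewrite [in leLHS](lagrange_interpolation xi sP) horner_sum.
apply: (le_trans (cmod_sum _ _ _)).
set M := \prod_(k < N.+1) _.
have S0 : 0 <= S by apply: le_trans (PS ord0); exact: cmod_ge0.
have -> : S * (N.+1%:R / (e * r)) * M = (S / e * (M / r)) *+ N.+1.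
  by rewrite -mulr_natl invfM; ring.
rewrite -[X in _ *+ X]card_ord -sumr_const; apply: ler_sum => i _.
rewrite hornerZ !cmodM cmodV horner_prod !cmod_prod.
under [X in _ * X <= _]eq_bigr do rewrite !hornerE.
apply: ler_pM; rewrite ?prodr_ge0//.
- by rewrite mulr_ge0 ?cmod_ge0// invr_ge0 prodr_ge0// => k _; exact: cmod_ge0.
- by move=> k _; exact: cmod_ge0.
- apply: ler_pM => //; first exact: cmod_ge0.
    by rewrite invr_ge0 prodr_ge0// => k _; exact: cmod_ge0.
  by rewrite lef_pV2 ?posrE//; apply: lt_le_trans (ex i).
- rewrite ler_pdivlMr// /M [leRHS](bigD1 i)//= mulrC; apply: ler_pM; rewrite ?(ltW r0)//.
  + by rewrite prodr_ge0// => k _; exact: cmod_ge0.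
  + by rewrite le_max lexx.
  + by apply: ler_prod => k _; rewrite cmod_ge0 le_max lexx orbT.
Qed.

(** Large powers make every factor independent of [s] irrelevant; the constants of the resultant and
    interpolation arguments disappear through this lemma. *)
Lemma le_of_geometric (A B c C : R) (N : nat) : 0 <= A -> 0 <= B -> 0 < c ->
  (forall s, (N <= s)%N -> c * A ^+ s <= C * B ^+ s) -> A <= B.
Proof.
move=> A0 B0 c0 h; rewrite leNgt; apply/negP => BA.
have A1 : 0 < A by apply: le_lt_trans BA.
have lim0 : (fun s => C * (B / A) ^+ s) @ \oo --> (0 : R).
  rewrite -(mulr0 C); apply: cvgM; first exact: cvg_cst.
  by apply: cvg_expr; rewrite ger0_norm ?divr_ge0// ltr_pdivrMr// mul1r.
have : c <= 0.
  rewrite -(cvg_lim _ lim0)//; apply: limr_ge; first by apply/cvg_ex; exists 0.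
  exists N => // s /= Ns.
  by rewrite expr_div_n mulrA ler_pdivlMr ?exprn_gt0//; exact: h.
by rewrite leNgt c0.
Qed.

(** Here [z] lists the roots of p, [kap] sends a root to its factor, and the l-th power of p is
    interpolated at one node more than its degree. *)
Lemma prod_dist_bound (n l m : nat) (z : 'I_n.+1 -> R[i]) (t : nat -> R[i])
    (kap : 'I_n.+1 -> nat) (x : 'I_(n.+1 * l).+1 -> R[i])
    (d : 'I_(n.+1 * l).+1 -> R) (S e r : R) :
  (forall j, (kap j < m)%N /\ z j != t (kap j)) -> injective x ->
  0 < r -> 0 < e ->
  (forall i, cmod (\prod_(j < n.+1) (x i - z j)) <= S) ->
  (forall i, e <= \prod_(k < (n.+1 * l).+1 | k != i) cmod (x i - x k)) ->
  (forall i k, (k < m)%N -> cmod (x i - t k) <= d i) ->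
  (\prod_(j < n.+1) cmod (z j - t (kap j))) ^+ l <=
    S ^+ l * ((n.+1 * l).+1%:R / (e * r)) * \prod_i (d i + r).
Proof.
move=> hz xi r0 e0 hS he hd; set N := (n.+1 * l)%N in x d xi hS he hd *.
have S0 : 0 <= S by apply: le_trans (hS ord0); exact: cmod_ge0.
pose c0 : R := (4 * n.+2%:R) ^- m.
have c00 : 0 < c0 by rewrite invr_gt0 exprn_gt0// mulr_gt0.
have d0 i : 0 <= d i + r.
  by rewrite addr_ge0 ?(ltW r0)// (le_trans _ (hd i _ (hz ord0).1))// cmod_ge0.
set B' := S ^+ l * (N.+1%:R / (e * r)).
have B'0 : 0 <= B' by rewrite !mulr_ge0 ?exprn_ge0// invr_ge0 ltW// mulr_gt0.
(* Neither constant involves [s]: each of the n+1 values of q, raised to the power l, loses [c0],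
   and near each of the N+1 nodes q is a sum of m terms with coefficients at most n+1. *)
apply: (@le_of_geometric _ _ ((c0 ^+ n.+1) ^+ l) ((m * n.+1)%:R ^+ N.+1) 0%N).
- by rewrite exprn_ge0// prodr_ge0// => j _; exact: cmod_ge0.
- by rewrite mulr_ge0// prodr_ge0.
- by rewrite !exprn_gt0.
move=> s _.
have [a [an ha]] := nonvanishing_combination m (fun j k => (z j - t k) ^+ s).
pose q : {poly R[i]} := \sum_(k < m) (a k)%:R *: ('X - (t k)%:P) ^+ s.
have qE w : q.[w] = \sum_(k < m) (a k)%:R * (w - t k) ^+ s.
  rewrite horner_sum; apply: eq_bigr => k _.
  by rewrite hornerZ horner_exp !hornerE.
have qz j : c0 * cmod (z j - t (kap j)) ^+ s <= cmod q.[z j].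
  by rewrite qE -cmodX; apply: ha; exact: (hz j).1.
have qn0 j : 0 < cmod q.[z j].
  apply: lt_le_trans (qz j); rewrite mulr_gt0// exprn_gt0// lt0r cmod_ge0 andbT.
  by rewrite cmod_eq0 subr_eq0; exact: (hz j).2.
(* The leading coefficient of q. It is at least 1, since otherwise all coefficients would be 0 and q
   would vanish at the z_j. *)
pose c := (\sum_(k < m) a k)%N.
have c1 : (0 < c)%N.
  rewrite lt0n; apply/eqP => /eqP; rewrite sum_nat_eq0 => /forallP ak.
  have := qn0 ord0; rewrite qE big1 ?cmod0 ?ltxx// => k _.
  by have /eqP -> := ak k; rewrite mul0r.
have qs : q`_s = c%:R.
  rewrite coef_sum natr_sum; apply: eq_bigr => k _; rewrite coefZ.
  have := monic_exp s (monicXsubC (t k)); rewrite monicE lead_coefE size_exp_XsubC.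
  by move=> /eqP ->; rewrite mulr1.
have sq : size q = s.+1.
  apply/anti_leq/andP; split; last first.
    by rewrite ltnNge; apply/negP => /leq_sizeP/(_ s (leqnn _))/eqP;
       rewrite qs pnatr_eq0 -leqn0 leqNgt c1.
  rewrite (leq_trans (size_sum _ _ _))//; apply/bigmax_leqP => k _.
  by rewrite (leq_trans (size_scale_leq _ _))// size_exp_XsubC.
have lq : lead_coef q = c%:R by rewrite lead_coefE sq.
have [rs qrs] := closed_field_poly_normal q; rewrite lq in qrs.
have srs : size rs = s.
  have : size (c%:R *: \prod_(w <- rs) ('X - w%:P) : {poly R[i]}) = s.+1 by rewrite -qrs.
  by rewrite size_scale ?size_prod_XsubC => [[]|]; rewrite // pnatr_eq0 -lt0n.
have qw w : cmod q.[w] = c%:R * \prod_(v <- rs) cmod (w - v).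
  rewrite qrs hornerZ cmodM cmod_nat horner_prod cmod_prod.
  by congr (_ * _); apply: eq_bigr => v _; rewrite !hornerE.
pose P : {poly R[i]} := (\prod_(j < n.+1) ('X - (z j)%:P)) ^+ l.
have Pw w : cmod P.[w] = (\prod_(j < n.+1) cmod (w - z j)) ^+ l.
  rewrite horner_exp cmodX horner_prod cmod_prod; congr (_ ^+ _).
  by apply: eq_bigr => j _; rewrite !hornerE.
have sP : (size P <= N.+1)%N.
  rewrite (leq_trans (size_poly_exp_leq _ _))// -big_enum/=.
  by rewrite size_prod_XsubC size_enum_ord.
have Pb w : cmod P.[w] <= B' * \prod_(k < N.+1) Num.max r (cmod (w - x k)).
  apply: lagrange_bound => // i; rewrite Pw -cmod_prod.
  by rewrite lerXn2r ?nnegrE// cmod_ge0.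
have lhs : ((c0 ^+ n.+1) ^+ l) * ((\prod_(j < n.+1) cmod (z j - t (kap j))) ^+ l) ^+ s
    <= (\prod_(j < n.+1) cmod q.[z j]) ^+ l.
  rewrite [X in _ * X]exprAC -exprMn lerXn2r ?nnegrE ?mulr_ge0 ?exprn_ge0 ?(ltW c00) ?prodr_ge0//.
  - by move=> j _; exact: cmod_ge0.
  - by move=> j _; exact: cmod_ge0.
  rewrite -prodrXl -[X in c0 ^+ X]card_ord -prodr_const -big_split/=.
  apply: ler_prod => j _; rewrite qz andbT mulr_ge0 ?exprn_ge0 ?cmod_ge0//.
  exact: ltW.
apply: (le_trans lhs).
(* Symmetry of the resultant: factoring q over its roots turns values of q at the z_j into values of
   P at the roots of q. *)
have -> : (\prod_(j < n.+1) cmod q.[z j]) ^+ l =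
    c%:R ^+ N * \prod_(w <- rs) cmod P.[w].
  rewrite (eq_bigr _ (fun j _ => qw (z j))).
  rewrite big_split/= prodr_const card_ord exprMn -exprM; congr (_ * _).
  rewrite exchange_big/= -prodrXl; apply: eq_bigr => w _; rewrite Pw.
  by congr (_ ^+ _); apply: eq_bigr => j _; rewrite cmodB.
apply: (@le_trans _ _ (c%:R ^+ N * \prod_(w <- rs) (B' * \prod_(k < N.+1) Num.max r (cmod (w - x k))))).
  rewrite ler_wpM2l ?exprn_ge0//; apply: ler_prod => w _.
  by rewrite cmod_ge0 Pb.
rewrite big_split/= big_const_seq count_predT srs iter_mulr_1 exchange_big/=.
rewrite [X in _ <= _ * X]exprMn mulrCA [leRHS]mulrCA ler_wpM2l ?exprn_ge0//.
have maxr0 (w y : R[i]) : 0 <= Num.max r (cmod (w - y)) by rewrite le_max (ltW r0).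
(* Each of the N+1 nodes receives one factor [c], which completes its product over the roots to a
   value of |q|. Only N are available, but [c] is at least 1. *)
apply: (@le_trans _ _ (\prod_(k < N.+1) (c%:R * \prod_(w <- rs) Num.max r (cmod (w - x k))))).
  rewrite big_split/= prodr_const card_ord ler_wpM2r//.
    by apply: prodr_ge0 => k _; apply: prodr_ge0 => w _.
  by apply: ler_weXn2l; rewrite ?ler1n.
rewrite -prodrXl -[X in _ ^+ X]card_ord -prodr_const -big_split/=.
apply: ler_prod => k _; rewrite mulr_ge0 ?prodr_ge0//=.
have [t' [t'r ht]] := prod_max_le_circle rs (x k) r0.
apply: (@le_trans _ _ (cmod q.[t'])); first by rewrite qw ler_wpM2l.
rewrite qE (le_trans (cmod_sum _ _ _))//.
rewrite natrM -mulrA mulr_natl -[X in _ *+ X]card_ord -sumr_const.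
apply: ler_sum => i _; rewrite cmodM cmod_nat cmodX; apply: ler_pM => //.
- by rewrite exprn_ge0 ?cmod_ge0.
- by rewrite ler_nat.
rewrite lerXn2r ?nnegrE ?cmod_ge0// (le_trans (cmod_triangle (x k) _ _))//.
by rewrite t'r addrC lerD2r; exact: hd.
Qed.

End interpolation.

(** * Measures on a compact set as limits of point masses *)

Section borel_plane.
Context {R : realType}.

Lemma open_cmodP (G : set (Cplane R)) :
  open G <-> forall z, G z -> exists2 e : R, 0 < e & forall w, cmod (z - w) < e -> G w.
Proof.
rewrite openE; split=> [oG z Gz|h z Gz]; last by apply: (nbhs_cmodP z G).2; exact: h.
by have /nbhs_cmodP := oG z Gz.
Qed.

Lemma measurable_open (G : set (Cplane R)) : open G -> measurable (G : set (borelC R)).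
Proof. by move=> oG; exact: sub_sigma_algebra. Qed.

Lemma lipschitz_measurable (K : R) (g : Cplane R -> R) :
  (forall z w, `|g z - g w| <= K * cmod (z - w)) ->
  measurable_fun setT (g : borelC R -> R).
Proof.
move=> gK; apply: (measurability _ (RGenOInfty.measurableE R)) => _ [_ [a ->] <-].
rewrite setTI; apply: measurable_open; apply/open_cmodP => z /=.
have K1 : 0 < `|K| + 1 by have := normr_ge0 K; lra.
rewrite in_itv/= andbT => az; exists ((g z - a) / (`|K| + 1)).
  by rewrite divr_gt0 ?subr_gt0.
move=> w; rewrite ltr_pdivlMr// => zw; rewrite in_itv/= andbT.
have h1 : K * cmod (z - w) <= `|K| * cmod (z - w).
  by rewrite ler_wpM2r ?cmod_ge0// ler_norm.
have := le_lt_trans (le_trans (ler_norm _) (le_trans (gK z w) h1)) _.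
move=> /(_ (g z - a)) h; rewrite -ltrN2 -(ltrD2l (g z)); apply: h.
by apply: le_lt_trans zw; rewrite mulrDr mulr1 mulrC lerDl cmod_ge0.
Qed.

Lemma uniform_prob_itv (a b : R) : 0 <= a -> a <= b -> b <= 1 ->
  uniform_prob (@ltr01 R) `[a, b[ = (b - a)%:E.
Proof.
move=> a0 ab b1; rewrite /uniform_prob.
rewrite (eq_integral (cst 1%E)) => [|x]; last first.
  rewrite inE/= in_itv/= /uniform_pdf => /andP[ax xb].
  by rewrite (le_trans a0 ax) (le_trans (ltW xb) b1) subr0 invr1.
rewrite integral_cst//= mul1e lebesgue_measure_itv/= lte_fin.
by case: ltgtP ab => // <- _; rewrite subrr.
Qed.

Lemma cmod_re_im (z : R[i]) :
  cmod z = Num.sqrt (complex.Re z ^+ 2 + complex.Im z ^+ 2).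
Proof. by rewrite /cmod normc_def. Qed.

Lemma measurable_Re : measurable_fun setT (@complex.Re R : borelC R -> R).
Proof.
apply: (@lipschitz_measurable 1) => z w; rewrite mul1r cmod_re_im !raddfB/=.
by rewrite -[leLHS]sqrtr_sqr ler_wsqrtr// lerDl sqr_ge0.
Qed.

Lemma measurable_Im : measurable_fun setT (@complex.Im R : borelC R -> R).
Proof.
apply: (@lipschitz_measurable 1) => z w; rewrite mul1r cmod_re_im !raddfB/=.
by rewrite -[leLHS]sqrtr_sqr ler_wsqrtr// lerDr sqr_ge0.
Qed.

Lemma measurable_dist :
  measurable_fun setT (fun p : borelC R * borelC R => cmod (p.1 - p.2 : Cplane R)).
Proof.
rewrite [X in measurable_fun _ X](_ : _ = fun p : borelC R * borelC R => Num.sqrt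
    ((complex.Re p.1 - complex.Re p.2) ^+ 2 + (complex.Im p.1 - complex.Im p.2) ^+ 2)).
  apply: measurableT_comp; first exact: continuous_measurable_fun (@sqrt_continuous R).
  apply: measurable_funD; apply: measurable_funX; apply: measurable_funB.
  - exact: measurableT_comp measurable_Re measurable_fst.
  - exact: measurableT_comp measurable_Re measurable_snd.
  - exact: measurableT_comp measurable_Im measurable_fst.
  - exact: measurableT_comp measurable_Im measurable_snd.
by apply/funext => p; rewrite cmod_re_im !raddfB.
Qed.

End borel_plane.

Section positive_functional.
Context {R : realType}.
Variable E : set (Cplane R).

Definition bounded_on (f : Cplane R -> R) :=
  exists M : R, forall z, E z -> `|f z| <= M.

(** A finitely additive mean. Its domain is all functions bounded on E, not just the continuous
    ones, so that indicators of cells have a mass. *)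
Record positive_functional (L : (Cplane R -> R) -> R) : Prop := {
  pf_add : forall f g, bounded_on f -> bounded_on g ->
    L (fun z => f z + g z) = L f + L g;
  pf_scale : forall (c : R) f, bounded_on f -> L (fun z => c * f z) = c * L f;
  pf_ge0 : forall f, bounded_on f -> (forall z, E z -> 0 <= f z) -> 0 <= L f;
  pf_one : L (fun=> 1) = 1 }.

Lemma bounded_onD f g : bounded_on f -> bounded_on g ->
  bounded_on (fun z => f z + g z).
Proof.
move=> [M fM] [N gN]; exists (M + N) => z Ez.
by rewrite (le_trans (ler_normD _ _))// lerD ?fM ?gN.
Qed.

Lemma bounded_onM f g : bounded_on f -> bounded_on g ->
  bounded_on (fun z => f z * g z).
Proof.
move=> [M fM] [N gN]; exists (M * N) => z Ez.
by rewrite normrM ler_pM ?fM ?gN.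
Qed.

Lemma bounded_on_cst c : bounded_on (fun=> c).
Proof. by exists `|c|. Qed.

Lemma bounded_on_bool (b : Cplane R -> bool) : bounded_on (fun z => (b z)%:R).
Proof. by exists 1 => z _; case: (b z); rewrite ?normr1 ?normr0. Qed.

Lemma pf_le L f g : positive_functional L -> bounded_on f -> bounded_on g ->
  (forall z, E z -> f z <= g z) -> L f <= L g.
Proof.
move=> pL bf bg fg.
have bN : bounded_on (fun z => -1 * f z) by apply: bounded_onM => //; exact: bounded_on_cst.
have := pf_ge0 pL (bounded_onD bg bN) _.
rewrite (pf_add pL)// (pf_scale pL)// mulN1r subr_ge0; apply => z Ez.
by rewrite mulN1r subr_ge0 fg.
Qed.

End positive_functional.

(** * Riesz representation by coding the points of E with binary digits *)

Section representation.
Context {R : realType}.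
Variable E : set (Cplane R).
Hypothesis cE : compact E.
Variable L : (Cplane R -> R) -> R.
Hypothesis pL : positive_functional E L.

(* Binary digits separating the points of E up to any prescribed scale. *)
Lemma separating_bits : exists B : nat -> Cplane R -> bool,
  forall n : nat, exists d : nat, forall z z', E z -> E z' ->
    (forall j, (j < d)%N -> B j z = B j z') -> cmod (z - z') < 2 / n.+1%:R.
Proof.
have net (n : nat) : exists s : seq (Cplane R),
    forall z, E z -> exists2 c, c \in s & cmod (z - c) < n.+1%:R^-1.
  have n0 : 0 < n.+1%:R^-1 :> R by rewrite invr_gt0.
  by have [s [_ sP]] := compact_net cE n0; exists s.
have [s sP] := choice net.
(* Bit [j] codes a pair (n, i) and tests whether z is within 1/(n+1) of the i-th point of the n-th
   net. Points of E that agree on all bits of level n share a net point. *)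
pose B j z := if unpickle j is Some (n, i)
  then cmod (z - nth 0 (s n) i) < n.+1%:R^-1 else false.
exists B => n; exists (\max_(i < size (s n)) (pickle (n, val i)).+1)%N.
move=> z z' Ez Ez' h.
have [c cs zc] := sP n z Ez.
have ci : (index c (s n) < size (s n))%N by rewrite index_mem.
have := h (pickle (n, index c (s n))) (@leq_bigmax _ (fun i : 'I__ => (pickle (n, val i)).+1) (Ordinal ci)).
rewrite /B pickleK nth_index// zc => /esym zc'.
rewrite (le_lt_trans (cmod_triangle c _ _))// (cmodB c z').
have -> : 2 / n.+1%:R = n.+1%:R^-1 + n.+1%:R^-1 :> R by rewrite mulr_natl mulr2n.
exact: ltrD.
Qed.

Fixpoint cell (B : nat -> Cplane R -> bool) (w : seq bool) (z : Cplane R) : bool :=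
  if w is b :: w' then (B (size w') z == b) && cell B w' z else true.

Lemma cell_bits B w z z' : cell B w z -> cell B w z' ->
  forall j, (j < size w)%N -> B j z = B j z'.
Proof.
elim: w => //= b w ih /andP[/eqP h1 c1] /andP[/eqP h2 c2] j.
by rewrite ltnS leq_eqVlt => /orP[/eqP->|/ih->//]; rewrite h1 h2.
Qed.

Definition mass B w := L (fun z => (cell B w z)%:R).

Lemma mass_split B w : mass B w = mass B (false :: w) + mass B (true :: w).
Proof.
rewrite /mass -(pf_add pL); [|exact: bounded_on_bool|exact: bounded_on_bool].
congr L; apply/funext => z /=.
by case: (B (size w) z) => /=; case: (cell B w z); rewrite ?addr0 ?add0r.
Qed.

Lemma mass_ge0 B w : 0 <= mass B w.
Proof. by apply: (pf_ge0 pL) => //; exact: bounded_on_bool. Qed.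

Lemma mass_nil B : mass B [::] = 1.
Proof. by rewrite /mass (pf_one pL). Qed.

Lemma mass_gt0 B w : 0 < mass B w -> exists2 z, E z & cell B w z.
Proof.
move=> m0; apply: contrapT => h; move: m0; apply/negP; rewrite -leNgt.
rewrite -[leRHS](mul0r (L (fun=> 1))) -(pf_scale pL); last exact: bounded_on_cst.
apply: (pf_le pL) => [||z Ez]; [exact: bounded_on_bool| |].
  by apply: bounded_onM; exact: bounded_on_cst.
rewrite mul0r; case cz: (cell B w z) => //.
by exfalso; apply: h; exists z.
Qed.

(** Words grow at the head. The slots of the words of a given length tile [0, 1[ in lexicographic
    order, each as long as the mass of its cell: an inverse distribution function for [mass]. *)
Fixpoint left_end B (w : seq bool) : R :=
  if w is b :: w' then left_end B w' + (if b then mass B (false :: w') else 0) else 0.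

Definition slot B w (u : R) := left_end B w <= u < left_end B w + mass B w.

Fixpoint code B (u : R) (d : nat) : seq bool :=
  if d is d'.+1 then
    let w := code B u d' in (left_end B w + mass B (false :: w) <= u) :: w
  else [::].

Lemma size_code B u d : size (code B u d) = d.
Proof. by elim: d => //= d ->. Qed.

Lemma slot_code B u d : 0 <= u < 1 -> slot B (code B u d) u.
Proof.
move=> u01; elim: d => [|d].
  by rewrite /slot/= mass_nil add0r.
rewrite /=; move: (code B u d) => w; rewrite /slot => /andP[h1 h2].
case: (leP (left_end B w + mass B (false :: w)) u) => h3; rewrite /=.
  by rewrite h3/= -addrA -mass_split.
by rewrite addr0 h1.
Qed.

Lemma slot_cons B b w u : slot B (b :: w) u ->
  slot B w u /\ (left_end B w + mass B (false :: w) <= u) = b.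
Proof.
rewrite /slot/= (mass_split B w).
have := mass_ge0 B (false :: w); have := mass_ge0 B (true :: w).
case: b => /=; move: (left_end B w) (mass B (false :: w)) (mass B (true :: w));
  move=> a m0 m1 m10 m00 /andP[h1 h2]; case: (leP (a + m0) u) => h3;
  split=> //; first [lra | exfalso; lra].
Qed.

Lemma code_slot B w u : slot B w u -> code B u (size w) = w.
Proof. by elim: w => //= b w ih /slot_cons[/ih -> ->]. Qed.

Lemma slot01 B w u : slot B w u -> 0 <= u < 1.
Proof.
elim: w => [|b w ih /slot_cons[/ih]//].
by rewrite /slot/= mass_nil add0r.
Qed.

Lemma slot_split B w u : slot B w u = slot B (false :: w) u || slot B (true :: w) u.
Proof.
apply/idP/idP => [su|/orP[]/slot_cons[]//].
have := slot_code B (size w).+1 (slot01 su); rewrite /= (code_slot su).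
by case: (_ <= u) => ->; rewrite ?orbT.
Qed.

Lemma measurable_code B d (h : seq bool -> R) :
  measurable_fun setT (fun u : measurableTypeR R => h (code B u d)).
Proof.
elim: d h => [|d ih] h; first by rewrite /=; exact: measurable_cst.
rewrite [X in measurable_fun _ X](_ : _ = fun u =>
    if left_end B (code B u d) + mass B (false :: code B u d) <= u
    then h (true :: code B u d) else h (false :: code B u d)).
  apply: measurable_fun_ifT.
  - apply: measurable_fun_ler; last exact: measurable_id.
    exact: (ih (fun w => left_end B w + mass B (false :: w))).
  - exact: (ih (fun w => h (true :: w))).
  - exact: (ih (fun w => h (false :: w))).
by apply/funext => u /=; case: ifP.
Qed.

Lemma uniform_slot B w :
  uniform_prob (@ltr01 R) [set u | slot B w u] = (mass B w)%:E.
Proof.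
have [wpos|] := ltP 0 (mass B w); last first.
  move=> w0; have w00 : mass B w = 0 by apply/le_anti; rewrite w0 mass_ge0.
  rewrite w00 (_ : [set u | _] = set0) ?measure0//.
  apply/seteqP; split=> // u; rewrite /slot/= w00 addr0 => /andP[h1 h2].
  by have := le_lt_trans h1 h2; rewrite ltxx.
have h0 : 0 <= left_end B w.
  by elim: w {wpos} => //= b w ih; rewrite addr_ge0//; case: b; rewrite ?mass_ge0.
have h1 : left_end B w + mass B w <= 1.
  elim: w {wpos h0} => [|b w ih]; first by rewrite /= mass_nil add0r.
  apply: le_trans ih; rewrite /= (mass_split B w).
  by case: b; rewrite -addrA lerD2l// add0r lerDl mass_ge0.
have -> : [set u | slot B w u] = `[left_end B w, left_end B w + mass B w[%classic.
  by apply/seteqP; split=> u; rewrite /= in_itv.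
rewrite uniform_prob_itv//; first by congr (_%:E); ring.
by rewrite lerDl mass_ge0.
Qed.


Lemma image_probability d1 d2 (T1 : measurableType d1) (T2 : measurableType d2)
    (P : probability T1 R) (X : T1 -> T2) : measurable_fun setT X ->
  exists Q : probability T2 R, (forall A, Q A = P (X @^-1` A)) /\
    forall f : T2 -> \bar R, measurable_fun setT f -> (forall y, 0 <= f y)%E ->
      (\int[Q]_y f y = \int[P]_x f (X x))%E.
Proof.
move=> mX; pose Xm : {mfun T1 >-> T2} := HB.pack X (isMeasurableFun.Build _ _ _ _ X mX).
exists (distribution P Xm); split=> // f mf f0.
exact: ge0_integral_distribution.
Qed.

Lemma cell_code_le B u m n z : (m <= n)%N -> cell B (code B u n) z -> cell B (code B u m) z.
Proof.
elim: n => [|n ih]; first by rewrite leqn0 => /eqP->.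
rewrite leq_eqVlt => /orP[/eqP->//|mn] /= /andP[_]; exact: ih.
Qed.

(** [X] is a uniform limit of functions of finitely many digits. A point is mapped into an open set
    exactly when, at some precision n, the whole disc of radius 2/(n+1) about its coded
    approximation lies in that set, which is a countable union of conditions on codes. *)
Lemma measurable_coded (B : nat -> Cplane R -> bool) (d : nat -> nat)
    (e : seq bool -> Cplane R) (X : R -> Cplane R) (z0 : Cplane R) :
  (forall u, ~ (0 <= u < 1) -> X u = z0) ->
  (forall u n, 0 <= u < 1 -> cmod (X u - e (code B u (d n))) <= 2 / n.+1%:R) ->
  measurable_fun setT (X : measurableTypeR R -> borelC R).
Proof.
move=> X0 Xe; apply: (@measurability _ _ (measurableTypeR R) (borelC R) setT X _ erefl) => _ [G oG <-]; rewrite setTI.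
pose Gn n (w : seq bool) := `[< forall z, cmod (e w - z) <= 2 / n.+1%:R -> G z >].
have -> : X @^-1` G = (`[0, 1[ `&` \bigcup_n [set u | Gn n (code B u (d n))])
    `|` (~` `[0, 1[ `&` [set _ | G z0]).
  apply/seteqP; split=> u /=.
    move=> Gu; have [u01|u01] := pselect (0 <= u < 1); last first.
      by right; rewrite in_itv/=; split=> //; rewrite -(X0 u u01).
    left; rewrite in_itv/=; split=> //.
    have [r r0 rG] := (open_cmodP G).1 oG _ Gu.
    exists (Num.truncn (4 / r)) => //=; apply/asboolP => z ez; apply: rG.
    set n := Num.truncn _ in ez *.
    have n4 : 4 / n.+1%:R < r.
      rewrite ltr_pdivrMr// mulrC -ltr_pdivrMr//; exact: truncnS_gt.
    apply: le_lt_trans n4; rewrite (le_trans (cmod_triangle (e (code B u (d n))) _ _))//.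
    have -> : 4 / n.+1%:R = 2 / n.+1%:R + 2 / n.+1%:R :> R by rewrite -mulrDl; congr (_ / _); ring.
    by apply: lerD => //; exact: Xe.
  move=> [[u01 [n _ /asboolP h]]|[u01 Gz0]]; last first.
    by rewrite X0//; move: u01; rewrite in_itv.
  by apply: h; rewrite cmodB; apply: Xe; move: u01; rewrite in_itv.
apply: measurableU; apply: measurableI.
- exact: measurable_itv.
- apply: bigcupT_measurable => n.
  rewrite (_ : [set _ | _] = (fun u => (Gn n (code B u (d n)))%:R) @^-1` [set (1 : R)]).
    rewrite -[X in measurable X]setTI.
    by apply: (measurable_code B (d n) (fun w => (Gn n w)%:R)).
  apply/seteqP; split=> u /=; first by move=> ->.
  by case: (Gn _ _) => //= /esym/eqP; rewrite oner_eq0.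
- by apply: measurableC; exact: measurable_itv.
- have [h|h] := pselect (G z0).
    by rewrite (_ : [set _ | _] = setT)//; apply/seteqP; split.
  by rewrite (_ : [set _ | _] = set0)//; apply/seteqP; split.
Qed.

(** The measure is the law of [X u] for u uniform on [0, 1[, where [X u] is a cluster point of
    samples from the nested cells of u. As [L] is only finitely additive, these cells may have no
    common point; [X u] is merely close to them, which suffices for Lipschitz functions. *)
Lemma representing_probability : exists mu : probability (borelC R) R,
  carried_by E mu /\
  forall (g : Cplane R -> R) (K M : R),
    (forall z w, `|g z - g w| <= K * cmod (z - w)) -> (forall z, 0 <= g z <= M) ->
    (\int[mu]_z (g z)%:E <= (L g)%:E)%E.
Proof.
have [B hB] := separating_bits; have [d dP] := choice hB.
have [z0 Ez0 _] : exists2 z, E z & cell B [::] z by apply: mass_gt0; rewrite mass_nil.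
have rep w : exists z, 0 < mass B w -> E z /\ cell B w z.
  have [/mass_gt0[z Ez cz]|h] := ltP 0 (mass B w); first by exists z.
  by exists z0.
have {rep}[e eP] := choice rep.
have mcode u n : 0 <= u < 1 -> 0 < mass B (code B u n).
  by move=> /(slot_code B n); rewrite /slot => /andP[h1 h2]; lra.
have approx u : exists z, E z /\ ((~ (0 <= u < 1) -> z = z0) /\ (0 <= u < 1 ->
    forall n z', E z' -> cell B (code B u (d n)) z' -> cmod (z - z') <= 2 / n.+1%:R)).
  have [u01|u01] := pselect (0 <= u < 1); last by exists z0.
  have [z Ez hz] := compact_cluster cE (fun n => (eP _ (mcode u n u01)).1).
  exists z; split=> //; split=> // _ n z' Ez' cz'.
  apply/ler_addgt0Pr => t t0; have [k dk kt] := hz (d n) t t0.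
  have [Ek ck] := eP _ (mcode u k u01).
  rewrite (le_trans (cmod_triangle (e (code B u k)) _ _))// addrC (cmodB z).
  apply: lerD; last exact: ltW.
  apply/ltW/dP => // j jd; apply: (cell_bits _ cz'); last by rewrite size_code.
  exact: cell_code_le dk ck.
have [X XP] := choice approx.
have XE u : E (X u) := (XP u).1.
have mX : measurable_fun setT (X : measurableTypeR R -> borelC R).
  apply: (@measurable_coded B d e X z0) => [u|u n u01]; first exact: (XP u).2.1.
  by have [] := eP _ (mcode u (d n) u01); exact: (XP u).2.2.
have [mu [muE muint]] := image_probability (uniform_prob (@ltr01 R)) mX.
exists mu; split.
  rewrite /carried_by muE (_ : _ @^-1` _ = set0) ?measure0//.
  by apply/seteqP; split=> // u /=; have := XE u.
move=> g K M gK gM.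
have mg := lipschitz_measurable gK.
rewrite muint; last 2 first.
- exact/measurable_EFinP.
- by move=> z; rewrite lee_fin; have /andP[] := gM z.
have bg : bounded_on E g.
  by exists M => z _; have /andP[h1 h2] := gM z; rewrite ger0_norm.
have K0 : 0 <= `|K| by [].
have gK' z w : `|g z - g w| <= `|K| * cmod (z - w).
  by rewrite (le_trans (gK z w))// ler_wpM2r ?cmod_ge0 ?ler_norm.
have mgX : measurable_fun setT (fun u : measurableTypeR R => (g (X u))%:E).
  by apply/measurable_EFinP; apply: (measurableT_comp mg).
have bgc w : bounded_on E (fun z => g z * (cell B w z)%:R).
  by apply: bounded_onM => //; exact: bounded_on_bool.
have mslot w : measurable ([set u | slot B w u] : set (measurableTypeR R)).
  have -> : [set u | slot B w u] = `[left_end B w, left_end B w + mass B w[%classic.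
    by apply/seteqP; split=> u; rewrite /= in_itv.
  exact: measurable_itv.
(* Induction on the number [j] of missing digits. At full depth one passes from [X u] to the sample
   point and from there to the points of the cell, each time at cost [eta]; shorter words follow by
   additivity. *)
have claim n j w : (size w + j = d n)%N ->
    (\int[uniform_prob (@ltr01 R)]_(u in [set u | slot B w u]) (g (X u))%:E
      <= (L (fun z => g z * (cell B w z)%:R)
          + `|K| * (4 / n.+1%:R) * mass B w)%:E)%E.
  pose eta := `|K| * (2 / n.+1%:R).
  have c1 : 0 <= eta by rewrite mulr_ge0 ?divr_ge0.
  have -> : `|K| * (4 / n.+1%:R) = eta + eta.
    by rewrite -mulrDr -mulrDl; congr (_ * (_ / _)); ring.
  have lip z z' : cmod (z - z') <= 2 / n.+1%:R -> g z <= g z' + eta.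
    move=> h; rewrite -lerBlDl (le_trans (ler_norm _))// (le_trans (gK' _ _))//.
    exact: ler_wpM2l.
  elim: j w => [|j ih] w.
    rewrite addn0 => sw; have [m0|m0] := ltP 0 (mass B w); last first.
      have m00 : mass B w = 0 by apply/le_anti; rewrite m0 mass_ge0.
      rewrite (_ : [set u | _] = set0) ?integral_set0.
        rewrite lee_fin m00 mulr0 addr0; apply: (pf_ge0 pL) => // z _.
        by rewrite mulr_ge0//; have /andP[] := gM z.
      apply/seteqP; split=> // u; rewrite /slot/= m00 addr0 => /andP[h1 h2].
      by have := le_lt_trans h1 h2; rewrite ltxx.
    have [Ez1 cz1] := eP _ m0; set z1 := e w in Ez1 cz1.
    have near z : E z -> cell B w z -> g z1 <= g z + eta.
      move=> Ez cz; apply: lip; apply/ltW/dP => // k kd.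
      by apply: (cell_bits cz1 cz); rewrite sw.
    apply: (@le_trans _ _ ((g z1 + eta) * mass B w)%:E).
      rewrite EFinM -uniform_slot -integral_cst//; apply: ge0_le_integral => //.
      - by move=> u _; rewrite lee_fin; have /andP[] := gM (X u).
      - exact: measurable_funTS.
      - move=> u su; rewrite lee_fin.
        have u01 := slot01 su; have cu := code_slot su; rewrite sw in cu.
        by apply: lip; apply: (XP u).2.2 => //; rewrite cu.
    have h1 : (g z1 - eta) * mass B w <= L (fun z => g z * (cell B w z)%:R).
      rewrite -(pf_scale pL); last exact: bounded_on_bool.
      apply: (pf_le pL) => // [|z Ez].
        by apply: bounded_onM; [exact: bounded_on_cst|exact: bounded_on_bool].
      by case cz: (cell B w z); rewrite ?mulr1 ?mulr0//; have := near z Ez cz; lra.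
    rewrite lee_fin; apply: le_trans (lerD h1 (lexx _)).
    by rewrite le_eqVlt; apply/orP; left; apply/eqP; ring.
  move=> sw.
  have -> : [set u | slot B w u] = [set u | slot B (false :: w) u] `|` [set u | slot B (true :: w) u].
    by apply/seteqP; split=> u /=; rewrite (slot_split B w); [move=> /orP|move=> h; apply/orP].
  rewrite ge0_integral_setU//; last 3 first.
  - exact: measurable_funTS.
  - by move=> u _; rewrite lee_fin; have /andP[] := gM (X u).
  - rewrite disj_set2E; apply/eqP/seteqP; split=> // u /= [/slot_cons[_ h1] /slot_cons[_]].
    by rewrite h1.
  apply: (le_trans (leeD (ih (false :: w) _) (ih (true :: w) _))); rewrite ?addSnnS//.
  rewrite -EFinD lee_fin (mass_split B w) mulrDr.
  have -> : L (fun z => g z * (cell B w z)%:R) =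
      L (fun z => g z * (cell B (false :: w) z)%:R) + L (fun z => g z * (cell B (true :: w) z)%:R).
    rewrite -(pf_add pL)//; congr L; apply/funext => z; rewrite -mulrDr; congr (_ * _) => /=.
    by case: (B (size w) z) => /=; case: (cell B w z); rewrite ?addr0 ?add0r.
  by rewrite le_eqVlt; apply/orP; left; apply/eqP; ring.
apply/lee_addgt0Pr => r r0.
pose n := Num.truncn (`|K| * 4 / r).
have := claim n (d n) [::] (add0n _).
have -> : [set u | slot B [::] u] = `[0, 1[%classic.
  by apply/seteqP; split=> u; rewrite /= in_itv/= /slot/= mass_nil add0r.
rewrite mass_nil mulr1 /= => h; rewrite -EFinD.
have h01 : uniform_prob (@ltr01 R) (~` `[0, 1[) = 0%E.
  rewrite probability_setC//; have /= -> := uniform_prob_itv (lexx (0 : R)) ler01 (lexx 1).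
  by rewrite subr0 subee.
rewrite (ge0_negligible_integral _ _ _ _ h01)//; last 2 first.
- exact: measurableC.
- by move=> u _; rewrite lee_fin; have /andP[] := gM (X u).
rewrite setTD setCK; apply: (le_trans h); rewrite lee_fin lerD//.
  by apply: (pf_le pL) => // [|z _]; [exact: (bgc [::])|rewrite mulr1].
rewrite mulrA ler_pdivrMr// -ler_pdivrMl// mulrC.
exact/ltW/truncnS_gt.
Qed.


End representation.

Section truncated_kernel.
Context {R : realType}.

(* A bounded Lipschitz substitute for log (D / |z - t|). *)
Definition clip_kernel (D d : R) (z t : Cplane R) : R :=
  ln D - ln (Num.min D (Num.max d (cmod (z - t)))).

Variables (D d : R).
Hypotheses (d0 : 0 < d) (dD : d <= D).

Let clip_bounds (x : R) : d <= Num.min D (Num.max d x) <= D.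
Proof. by rewrite le_min dD le_max lexx/= ge_min lexx. Qed.

Lemma clip_kernel_bounds z t : 0 <= clip_kernel D d z t <= ln D - ln d.
Proof.
have /andP[h1 h2] := clip_bounds (cmod (z - t)).
have D0 := lt_le_trans d0 dD; have c0 := lt_le_trans d0 h1.
by rewrite /clip_kernel subr_ge0 lerD2l lerN2 !ler_ln ?posrE// h1 h2.
Qed.

Lemma clip_dist (x y : R) :
  `|Num.min D (Num.max d x) - Num.min D (Num.max d y)| <= `|x - y|.
Proof.
wlog yx : x y / y <= x => [hw|].
  by have [/hw//|/ltW/hw] := leP y x; rewrite distrC (distrC y).
have [a0 ax] : 0 <= Num.max d x - Num.max d y /\ Num.max d x - Num.max d y <= x - y.
  by rewrite !maxEle; case: (leP d x) => h1; case: (leP d y) => h2; split; lra.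
move: (Num.max d x) (Num.max d y) a0 ax => a b a0 ax.
rewrite [leRHS]ger0_norm ?subr_ge0// ger0_norm.
  by rewrite !minEle; case: (leP D a) => h1; case: (leP D b) => h2; lra.
by rewrite !minEle; case: (leP D a) => h1; case: (leP D b) => h2; lra.
Qed.

Lemma ler_ln_dist (x y : R) : d <= x -> d <= y -> `|ln x - ln y| <= `|x - y| / d.
Proof.
wlog yx : x y / y <= x => [hw dx dy|dx dy].
  have [/hw|/ltW/hw h] := leP y x; first exact.
  by rewrite distrC (distrC x); exact: h.
have y0 := lt_le_trans d0 dy; have x0 := lt_le_trans y0 yx.
rewrite !ger0_norm ?subr_ge0 ?ler_ln ?posrE// -ln_div ?posrE//.
have -> : x / y = 1 + (x - y) / y by rewrite mulrBl divff ?gt_eqF//; ring.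
have q0 : 0 <= (x - y) / y by rewrite divr_ge0 ?subr_ge0 ?(ltW y0).
apply: (@le_trans _ _ ((x - y) / y)); last first.
  by rewrite ler_wpM2l ?subr_ge0// lef_pV2 ?posrE.
by apply: le_ln1Dx; rewrite (lt_le_trans _ q0)// ltrN10.
Qed.

Lemma clip_kernel_lipschitz z t t' :
  `|clip_kernel D d z t - clip_kernel D d z t'| <= d^-1 * cmod (t - t').
Proof.
have /andP[h1 _] := clip_bounds (cmod (z - t)).
have /andP[h2 _] := clip_bounds (cmod (z - t')).
rewrite /clip_kernel opprB addrC addrA subrK mulrC.
apply: (le_trans (ler_ln_dist h2 h1)); rewrite ler_pM2r ?invr_gt0//.
have h : `|cmod (z - t') - cmod (z - t)| <= cmod (t - t').
  rewrite ler_norml; have := cmod_triangle t z t'; have := cmod_triangle t' z t.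
  rewrite (cmodB t' t) => h3 h4; apply/andP; split; lra.
exact: le_trans (clip_dist _ _) h.
Qed.

Lemma clip_kernelC z t : clip_kernel D d z t = clip_kernel D d t z.
Proof. by rewrite /clip_kernel cmodB. Qed.

Lemma clip_kernel_diag z : clip_kernel D d z z = ln D - ln d.
Proof.
by rewrite /clip_kernel subrr cmod0 (max_idPl (ltW d0)) (min_idPr dD).
Qed.

Lemma clip_kernel_le z t : 0 < cmod (z - t) -> cmod (z - t) <= D ->
  clip_kernel D d z t <= ln D - ln (cmod (z - t)).
Proof.
move=> h0 h1; rewrite lerD2l lerN2 ler_ln ?posrE ?le_min ?h1 ?le_max ?lexx ?orbT//.
by have /andP[h _] := clip_bounds (cmod (z - t)); exact: lt_le_trans h.
Qed.

Lemma measurable_clip_kernel :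
  measurable_fun setT (fun p : borelC R * borelC R => clip_kernel D d p.1 p.2).
Proof.
apply: measurable_funB; first exact: measurable_cst.
apply: (measurableT_comp (@measurable_ln R)).
apply: measurable_minr; first exact: measurable_cst.
by apply: measurable_maxr; [exact: measurable_cst|exact: measurable_dist].
Qed.

End truncated_kernel.

(** * Limits of averages over point configurations *)

Section ultralimit.
Context {R : realType}.
Variable U : set_system nat.
Hypothesis UU : UltraFilter U.

Lemma ultra_bounded_cvg (a : nat -> R) (M : R) :
  (forall n, `|a n| <= M) -> cvg (a @ U).
Proof.
move=> aM; have PU := @ultra_proper _ _ UU.
have cM : compact `[- M, M]%classic := @segment_compact _ (- M) M.
have [|p [_ clp]] := cM (a @ U) _ _.
  apply: (@filterE _ U) => n. by rewrite /= in_itv/= -ler_norml.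
apply/cvg_ex; exists p => V Vp.
have [//|h] := in_ultra_setVsetC (a @^-1` V) UU.
by have [x [h1 h2]] := clp (~` V) V h Vp.
Qed.

Variables (E : set (Cplane R)) (len : nat -> nat) (pt : forall N, 'I_(len N) -> Cplane R).
Hypotheses (len0 : forall N, (0 < len N)%N) (ptE : forall N (i : 'I_(len N)), E (pt i)).

Definition average N (f : Cplane R -> R) := (\sum_(i < len N) f (@pt N i)) / (len N)%:R.

(** Along an ultrafilter the averages of every bounded function converge, so one choice of [U]
    serves all of them at once and the limit is linear. *)
Definition average_limit f := lim (average ^~ f @ U).

Lemma average_le N f g : (forall z, E z -> f z <= g z) -> average N f <= average N g.
Proof.
by move=> fg; rewrite ler_wpM2r ?invr_ge0//; apply: ler_sum => i _; exact: fg.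
Qed.

Lemma average_cst N c : average N (fun=> c) = c.
Proof.
rewrite /average sumr_const card_ord -[c *+ _]mulr_natl mulrAC divff ?mul1r//.
by rewrite pnatr_eq0 -lt0n.
Qed.

Lemma averageDc N f c : average N f + c = average N (fun z => f z + c).
Proof. by rewrite -{1}(average_cst N c) -mulrDl -big_split. Qed.

Lemma average_cvg f : bounded_on E f -> average ^~ f @ U --> average_limit f.
Proof.
move=> [M fM]; apply: (@ultra_bounded_cvg _ M) => N.
rewrite ler_norml -[leLHS](average_cst N) -[X in _ && (_ <= X)](average_cst N).
by apply/andP; split; apply: average_le => z /fM; rewrite ler_norml => /andP[].
Qed.

Lemma average_positive : positive_functional E average_limit.
Proof.
have PU := @ultra_proper _ _ UU.
split.
- move=> f g bf bg; apply: cvg_lim => //.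
  rewrite (_ : average ^~ _ = fun N => average N f + average N g).
    by apply: cvgD; exact: average_cvg.
  by apply/funext => N; rewrite /average big_split/= mulrDl.
- move=> c f bf; apply: cvg_lim => //.
  rewrite (_ : average ^~ _ = fun N => c * average N f).
    by apply: cvgM; [exact: cvg_cst|exact: average_cvg].
  by apply/funext => N; rewrite /average -mulr_sumr mulrA.
- move=> f bf f0; apply: limr_ge; first by apply/cvg_ex; exists (average_limit f); exact: average_cvg.
  by apply: filterE => N; rewrite -(average_cst N 0); exact: average_le.
- rewrite /average_limit (_ : average ^~ _ = fun=> 1); first exact: lim_cst.
  by apply/funext => N; rewrite average_cst.
Qed.

End ultralimit.

(** * Asymptotic lower bound for the energy of distinct points *)

Section discrete_energy.
Context {R : realType}.

Definition discrete_energy n (x : 'I_n -> Cplane R) : R :=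
  \sum_(i < n) \sum_(k < n | k != i) - ln (cmod (x i - x k)).

(** Clipping makes the diagonal finite, and it contributes only order 1/n to the mean; the other
    error term pays for replacing n(n-1) by n^2. *)
Lemma clip_average_le (D d c : R) n (x : 'I_n -> Cplane R) :
  0 < d -> d <= D -> (0 < n)%N -> injective x ->
  (forall i k, cmod (x i - x k) <= D) ->
  discrete_energy x <= n%:R * n.-1%:R * c ->
  (\sum_(i < n) \sum_(k < n) clip_kernel D d (x i) (x k)) / n%:R ^+ 2 <=
    ln D + c + (ln D - ln d + `|ln D + c|) / n%:R.
Proof.
move=> d0 dD n0 xi xD xc.
have n0' : 0 < n%:R :> R by rewrite ltr0n.
have h : \sum_(i < n) \sum_(k < n) clip_kernel D d (x i) (x k) <=
    n%:R * (ln D - ln d) + n%:R * n.-1%:R * (ln D + c).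
  have -> : n%:R * (ln D - ln d) = \sum_(i < n) (ln D - ln d).
    by rewrite sumr_const card_ord mulr_natl.
  rewrite [X in _ + X]mulrDr.
  have -> : n%:R * n.-1%:R * ln D = \sum_(i < n) \sum_(k < n | k != i) ln D.
    rewrite (eq_bigr (fun=> n.-1%:R * ln D)) => [|i _].
      by rewrite sumr_const card_ord -(mulr_natl (n.-1%:R * ln D)) mulrA.
    by rewrite sumr_const cardC1 card_ord mulr_natl.
  rewrite addrA; apply: le_trans (lerD (lexx _) xc).
  rewrite /discrete_energy -!big_split/=; apply: ler_sum => i _.
  rewrite (bigD1 i)//= clip_kernel_diag// -[leRHS]addrA lerD2l -big_split/=.
  apply: ler_sum => k ki; apply: clip_kernel_le => //.
  by rewrite lt0r cmod_ge0 andbT cmod_eq0 subr_eq0 (inj_eq xi) eq_sym.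
rewrite ler_pdivrMr ?exprn_gt0// (le_trans h)//.
have -> : (ln D + c + (ln D - ln d + `|ln D + c|) / n%:R) * n%:R ^+ 2 =
    n%:R * (ln D - ln d) + (n%:R ^+ 2 * (ln D + c) + n%:R * `|ln D + c|).
  by field; rewrite gt_eqF.
rewrite lerD2l -subr_ge0.
have -> : n%:R ^+ 2 * (ln D + c) + n%:R * `|ln D + c| - n%:R * n.-1%:R * (ln D + c) =
    n%:R * ((ln D + c) + `|ln D + c|) :> R.
  have -> : n%:R = n.-1%:R + 1 :> R by rewrite natr1 prednK.
  by ring.
by rewrite mulr_ge0 ?(ltW n0')//; have := ler_norm (- (ln D + c)); rewrite normrN; lra.
Qed.

Variable E : set (Cplane R).
Hypothesis cE : compact E.
Variables (v D : R).
Hypothesis ED : forall z t, E z -> E t -> cmod (z - t) <= D.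
Hypothesis hv : forall (mu : probability (borelC R) R), carried_by E mu ->
  forall e : R, 0 < e -> exists2 d : R, 0 < d <= D &
    ((v + ln D - e)%:E < \int[mu]_z \int[mu]_t (clip_kernel D d z t)%:E)%E.

(* Otherwise an ultralimit of bad configurations would be represented by a
   measure on E with too small an energy. *)
Lemma discrete_energy_lower_bound (e : R) : 0 < e -> exists N : nat,
  forall n (x : 'I_n -> Cplane R), (N <= n)%N -> injective x ->
    (forall i, E (x i)) -> n%:R * n.-1%:R * (v - e) <= discrete_energy x.
Proof.
move=> e0; apply: contrapT => hN.
have bad N : exists s : {n : nat & 'I_n -> Cplane R}, [/\ (N < projT1 s)%N,
    injective (projT2 s), (forall i, E (projT2 s i)) &
    discrete_energy (projT2 s) <= (projT1 s)%:R * (projT1 s).-1%:R * (v - e)].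
  apply: contrapT => h; apply: hN; exists N.+1 => n x Nn xi xE.
  rewrite leNgt; apply/negP => hx; apply: h; exists (existT _ n x); split=> //=.
  exact: ltW.
have {bad}[s sP] := choice bad.
pose len N := projT1 (s N); pose pt N : 'I_(len N) -> Cplane R := projT2 (s N).
have len0 N : (0 < len N)%N by have [h _ _ _] := sP N; exact: leq_ltn_trans (leq0n N) h.
have ptE N (i : 'I_(len N)) : E (pt N i) by have [_ _ h _] := sP N; exact: h.
have [U [UU FU]] := ultraFilterLemma eventually_filter.
have PU := @ultra_proper _ _ UU.
pose A := average pt; pose L := average_limit U pt.
have pL : positive_functional E L by exact: average_positive.
have [mu [muE mug]] := representing_probability cE pL.
have e4 : 0 < e / 4 by rewrite divr_gt0.
have [d /andP[d0 dD]] := hv muE e4.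
apply/negP; rewrite -leNgt.
pose phi z := L (fun t => clip_kernel D d z t).
have bk z : bounded_on E (fun t => clip_kernel D d z t).
  exists (ln D - ln d) => t _; have /andP[h1 h2] := clip_kernel_bounds d0 dD z t.
  by rewrite ger0_norm.
have kL z z' t : clip_kernel D d z t <= clip_kernel D d z' t + d^-1 * cmod (z - z').
  rewrite -lerBlDl (le_trans (ler_norm _))// !(clip_kernelC _ _ _ t).
  exact: clip_kernel_lipschitz.
have phiL z z' : phi z <= phi z' + d^-1 * cmod (z - z').
  have -> : phi z' + d^-1 * cmod (z - z') = L (fun t => clip_kernel D d z' t + d^-1 * cmod (z - z') * 1).
    rewrite (pf_add pL)//; last by apply: bounded_onM; exact: bounded_on_cst.
    by rewrite (pf_scale pL) ?(pf_one pL) ?mulr1//; exact: bounded_on_cst.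
  apply: (pf_le pL) => // [|t _].
    apply: bounded_onD => //; exact: bounded_on_cst.
  by rewrite mulr1.
have phi_lip z z' : `|phi z - phi z'| <= d^-1 * cmod (z - z').
  rewrite ler_norml; have := phiL z z'; have := phiL z' z; rewrite (cmodB z').
  move: (d^-1 * _) => r h1 h2; apply/andP; split; lra.
have phi_bd z : 0 <= phi z <= ln D - ln d.
  apply/andP; split.
    by apply: (pf_ge0 pL) => // t _; have /andP[] := clip_kernel_bounds d0 dD z t.
  have -> : ln D - ln d = L (fun=> (ln D - ln d) * 1).
    by rewrite (pf_scale pL) ?(pf_one pL) ?mulr1//; exact: bounded_on_cst.
  apply: (pf_le pL) => // [|t _]; first exact: bounded_on_cst.
  by rewrite mulr1; have /andP[] := clip_kernel_bounds d0 dD z t.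
(* [mug] concerns functions of one variable, so it is used twice: on the kernel in t, then on [phi],
   which inherits the bounds and the Lipschitz constant of the kernel. *)
apply: (@le_trans _ _ (\int[mu]_z (phi z)%:E)%E).
  apply: ge0_le_integral => //.
  - move=> z _; apply: integral_ge0 => t _; rewrite lee_fin.
    by have /andP[] := clip_kernel_bounds d0 dD z t.
  - apply: (measurable_fun_fubini_tonelli_F
      (fun p : borelC R * borelC R => (clip_kernel D d p.1 p.2)%:E)).
    + by apply/measurable_EFinP; exact: measurable_clip_kernel.
    + by move=> p; rewrite lee_fin; have /andP[] := clip_kernel_bounds d0 dD p.1 p.2.
  - by apply/measurable_EFinP; exact: (lipschitz_measurable phi_lip).
  - move=> z _; apply: (mug _ _ (ln D - ln d)).
      by move=> t t'; exact: clip_kernel_lipschitz.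
    by move=> t; exact: clip_kernel_bounds.
apply: (le_trans (mug _ _ _ phi_lip phi_bd)); rewrite lee_fin.
(* Comparing the average of [phi] with the double average requires convergence uniform in the first
   variable. The ultrafilter gives it at finitely many points; a net of this mesh and the Lipschitz
   constant 1/d extend it to E. *)
have d16 : 0 < d * (e / 16) by rewrite mulr_gt0 ?divr_gt0.
have [net [netE netP]] := compact_net cE d16.
have nearA (s0 : seq (Cplane R)) : \forall N \near U, forall c, c \in s0 ->
    phi c <= A N (fun t => clip_kernel D d c t) + e / 16.
  elim: s0 => [|c s0 ih]; first exact: filterE.
  have hc : \forall N \near U, phi c <= A N (fun t => clip_kernel D d c t) + e / 16.
    have e16 : 0 < e / 16 by rewrite divr_gt0.
    have /cvgrPdist_le/(_ _ e16) := average_cvg UU len0 ptE (bk c).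
    apply: filterS => N; rewrite ler_norml => /andP[_]; rewrite -/(A N _) -/L -/(phi c).
    by rewrite lerBlDl.
  apply: filterS2 hc ih => N h1 h2 c'; rewrite in_cons => /orP[/eqP->//|]; exact: h2.
pose K := ln D - ln d + `|ln D + (v - e)|.
have K0 : 0 <= K.
  have /andP[h1 h2] := clip_kernel_bounds d0 dD 0 0.
  by rewrite addr_ge0// (le_trans h1).
have nearN : \forall N \near U, K / (len N)%:R <= e / 8.
  apply: FU; exists (Num.truncn (8 * K / e)).+1 => // N /= leN.
  have l0 : 0 < (len N)%:R :> R by rewrite ltr0n.
  rewrite ler_pdivrMr//.
  have : 8 * K / e <= (len N)%:R.
    apply/ltW; apply: lt_le_trans (truncnS_gt _) _; rewrite ler_nat.
    by apply: leq_trans leN _; have [h _ _ _] := sP N; exact: ltnW.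
  rewrite ler_pdivrMr//; move: (len N)%:R => l; lra.
apply: limr_le; first by apply/cvg_ex; exists (L phi); apply: (average_cvg UU len0 ptE); exists (ln D - ln d) => z _; have /andP[h1 h2] := phi_bd z; rewrite ger0_norm.
apply: filterS2 (nearA net) nearN => N hnet hKN.
have unif z : E z -> phi z <= A N (fun t => clip_kernel D d z t) + 3 * e / 16.
  move=> Ez; have [c cn zc] := netP z Ez; have := hnet c cn.
  have small : d^-1 * cmod (z - c) <= e / 16 by rewrite ler_pdivrMl// ltW.
  have := phiL z c.
  have : A N (fun t => clip_kernel D d c t) <= A N (fun t => clip_kernel D d z t) + e / 16.
    rewrite /A averageDc//.
    apply: (average_le ptE) => // t _; apply: le_trans (kL c z t) _.
    by rewrite lerD2l cmodB.
  lra.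
have [lN xi xE xc] := sP N.
have dbl : A N (fun z => A N (fun t => clip_kernel D d z t)) <= ln D + (v - e) + e / 8.
  apply: le_trans (lerD (lexx (ln D + (v - e))) hKN).
  apply: le_trans (clip_average_le d0 dD (len0 N) xi _ xc); last by move=> i k; apply: ED.
  by rewrite /A /average -mulr_suml -mulrA -invfM expr2.
have : A N phi <= A N (fun z => A N (fun t => clip_kernel D d z t)) + 3 * e / 16.
  rewrite /A averageDc//.
  by apply: (average_le ptE) => // t Et; exact: unif.
rewrite -/(A N phi); move: dbl; lra.
Qed.

End discrete_energy.

(** * Potentials of the equilibrium measure *)

Section positive_kernel.
Context {R : realType}.

(* log (D / |z - t|), nonnegative everywhere because |z - t| is capped at D. *)
Definition pos_kernel (D : R) (z t : Cplane R) : \bar R :=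
  if cmod (z - t) == 0 then +oo%E else (ln D - ln (Num.min D (cmod (z - t))))%:E.

Variable D : R.
Hypothesis D1 : 1 <= D.

Let D0 : 0 < D. Proof. exact: lt_le_trans D1. Qed.

Lemma pos_kernel_ge0 z t : (0 <= pos_kernel D z t)%E.
Proof.
rewrite /pos_kernel; case: ifPn => // zt; rewrite lee_fin subr_ge0.
have zt0 : 0 < cmod (z - t) by rewrite lt0r zt cmod_ge0.
by rewrite ler_ln ?posrE// ?lt_min ?D0// ge_min lexx.
Qed.

Lemma pos_kernelC z t : pos_kernel D z t = pos_kernel D t z.
Proof. by rewrite /pos_kernel cmodB. Qed.

Lemma measurable_pos_kernel :
  measurable_fun setT (fun p : borelC R * borelC R => pos_kernel D p.1 p.2).
Proof.
apply: measurable_fun_ifT.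
- apply: measurable_fun_eqr; first exact: measurable_dist.
  exact: measurable_cst.
- exact: measurable_cst.
- apply/measurable_EFinP/measurable_funB; first exact: measurable_cst.
  apply: (measurableT_comp (@measurable_ln R)).
  by apply: measurable_minr; [exact: measurable_cst|exact: measurable_dist].
Qed.

Let measurable_pairl (z : borelC R) :
  measurable_fun setT (fun t : borelC R => (z, t)).
Proof.
by apply/measurable_fun_pairP; split; [exact: measurable_cst|exact: measurable_id].
Qed.

Lemma measurable_pos_kernelr (z : Cplane R) :
  measurable_fun setT (fun t : borelC R => pos_kernel D z t).
Proof. exact: (measurableT_comp measurable_pos_kernel (measurable_pairl z)). Qed.

Lemma measurable_potential (mu : probability (borelC R) R) :
  measurable_fun setT (fun z : borelC R => \int[mu]_t pos_kernel D z t)%E.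
Proof.
apply: (measurable_fun_fubini_tonelli_F
  (fun p : borelC R * borelC R => pos_kernel D p.1 p.2)).
- exact: measurable_pos_kernel.
- by move=> p; exact: pos_kernel_ge0.
Qed.

Lemma pos_kernel_fin z t : 0 < cmod (z - t) -> cmod (z - t) <= D ->
  pos_kernel D z t = (ln D - ln (cmod (z - t)))%:E.
Proof. by move=> zt0 ztD; rewrite /pos_kernel gt_eqF// (min_idPr ztD). Qed.

Lemma pos_kernel_log z t : cmod (z - t) <= D ->
  log_kernel z t = (pos_kernel D z t + (- ln D)%:E)%E.
Proof.
move=> ztD; have [zt|zt] := eqVneq (cmod (z - t)) 0.
  by rewrite /log_kernel /pos_kernel zt eqxx le0_lneNy.
have zt0 : 0 < cmod (z - t) by rewrite lt0r zt cmod_ge0.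
rewrite pos_kernel_fin// /log_kernel lne_EFin// -EFinN -EFinD; congr (_%:E); ring.
Qed.

Lemma measurable_log_kernel :
  measurable_fun setT (fun p : borelC R * borelC R => log_kernel (p.1 : Cplane R) p.2).
Proof.
rewrite [X in measurable_fun _ X](_ : _ = fun p : borelC R * borelC R =>
    if cmod (p.1 - p.2 : Cplane R) == 0 then +oo%E
    else (- ln (cmod (p.1 - p.2 : Cplane R)))%:E).
  apply: measurable_fun_ifT.
  - apply: measurable_fun_eqr; [exact: measurable_dist|exact: measurable_cst].
  - exact: measurable_cst.
  - apply/measurable_EFinP; apply: measurableT_comp => //.
    exact: (measurableT_comp (@measurable_ln R) measurable_dist).
apply/funext => p; rewrite /log_kernel; case: ifPn => [/eqP ->|zt].
  by rewrite le0_lneNy.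
by rewrite lne_EFin ?EFinN// lt0r zt cmod_ge0.
Qed.

Lemma measurable_log_potential (mu : probability (borelC R) R) :
  measurable_fun setT (fun z : borelC R => \int[mu]_t log_kernel (z : Cplane R) t)%E.
Proof.
pose G (p : borelC R * borelC R) := log_kernel (p.1 : Cplane R) p.2.
have mG : measurable_fun setT G := measurable_log_kernel.
rewrite [X in measurable_fun _ X](_ : _ =
    fun z => (fubini_F mu G^\+ z - fubini_F mu G^\- z)%E).
  apply: emeasurable_funB; apply: measurable_fun_fubini_tonelli_F => //.
  - exact: measurable_funepos.
  - exact: measurable_funeneg.
apply/funext => z; rewrite integralE /fubini_F; congr (_ - _)%E.
  by apply: eq_integral => t _; rewrite !funeposE.
by apply: eq_integral => t _; rewrite !funenegE.
Qed.

Lemma clip_kernel_cvg z t :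
  ((clip_kernel D n.+1%:R^-1 z t)%:E @[n --> \oo] --> pos_kernel D z t)%E.
Proof.
have [zt|zt] := eqVneq (cmod (z - t)) 0.
  rewrite /pos_kernel zt eqxx; apply/cvgeyPge => M.
  exists (Num.truncn (expR (M - ln D))) => // n /= hn; rewrite lee_fin /clip_kernel zt.
  have n0 : 0 < n.+1%:R :> R by rewrite ltr0n.
  have nD : n.+1%:R^-1 <= D by rewrite (le_trans _ D1)// invf_le1// ler1n.
  rewrite (max_idPl _) ?invr_ge0 ?ltW// (min_idPr nD) lnV ?posrE// opprK.
  rewrite -ltrBlDl -ltr_expR lnK ?posrE//.
  by apply: lt_le_trans (truncnS_gt _) _; rewrite ler_nat.
have zt0 : 0 < cmod (z - t) by rewrite lt0r zt cmod_ge0.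
apply: cvg_near_cst; exists (Num.truncn (cmod (z - t))^-1) => // n /= hn.
rewrite /pos_kernel (negbTE zt) /clip_kernel; congr (_ - ln (Num.min _ _))%:E.
apply/max_idPr; rewrite -[leRHS]invrK lef_pV2 ?posrE ?invr_gt0//.
by apply/ltW; apply: lt_le_trans (truncnS_gt _) _; rewrite ler_nat.
Qed.

Lemma clip_kernel_nondecreasing z t m n : (m <= n)%N ->
  clip_kernel D m.+1%:R^-1 z t <= clip_kernel D n.+1%:R^-1 z t.
Proof.
move=> mn; rewrite /clip_kernel lerD2l lerN2.
have h : n.+1%:R^-1 <= m.+1%:R^-1 :> R by rewrite lef_pV2 ?posrE// ler_nat.
have n0 : 0 < n.+1%:R^-1 :> R by rewrite invr_gt0.
have pos (k : nat) : 0 < Num.min D (Num.max k.+1%:R^-1 (cmod (z - t))).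
  by rewrite lt_min D0 lt_max invr_gt0 ltr0n.
rewrite ler_ln ?posrE// le_min ge_min lexx/= ge_min; apply/orP; right.
by rewrite ge_max !le_max h lexx orbT.
Qed.

(* Monotone convergence as the clipping distance tends to 0. *)
Lemma clip_energy_gt (mu : probability (borelC R) R) (c : R) :
  (c%:E < \int[mu]_z \int[mu]_t pos_kernel D z t)%E ->
  exists2 d : R, 0 < d <= D & (c%:E < \int[mu]_z \int[mu]_t (clip_kernel D d z t)%:E)%E.
Proof.
move=> hc; apply: contrapT => h.
have d0 (n : nat) : 0 < n.+1%:R^-1 :> R by rewrite invr_gt0.
have dD (n : nat) : n.+1%:R^-1 <= D by rewrite (le_trans _ D1)// invf_le1// ler1n.
have hn (n : nat) : (\int[mu]_z \int[mu]_t (clip_kernel D n.+1%:R^-1 z t)%:E <= c%:E)%E.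
  by rewrite leNgt; apply/negP => hlt; apply: h; exists n.+1%:R^-1; rewrite // d0 dD.
have mclip n : measurable_fun setT (fun p : borelC R * borelC R => (clip_kernel D n.+1%:R^-1 p.1 p.2)%:E).
  by apply/measurable_EFinP; exact: measurable_clip_kernel.
have clip0 n (p : borelC R * borelC R) : (0 <= (clip_kernel D n.+1%:R^-1 p.1 p.2)%:E)%E.
  by rewrite lee_fin; have /andP[] := clip_kernel_bounds (d0 n) (dD n) p.1 p.2.
move: hc; apply/negP; rewrite -leNgt.
rewrite -[leLHS](@fubini_tonelli1 _ _ _ _ _ mu mu (fun p => pos_kernel D p.1 p.2)); last 2 first.
- exact: measurable_pos_kernel.
- by move=> p; exact: pos_kernel_ge0.
have cvgI := @cvg_monotone_convergence _ _ R (mu \x mu)%E setT measurableT _ mclip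
  (fun n p _ => clip0 n p) _.
have -> : (\int[mu \x mu]_p pos_kernel D p.1 p.2)%E =
    (\int[mu \x mu]_p limn (fun n => (clip_kernel D n.+1%:R^-1 p.1 p.2)%:E))%E.
  by apply: eq_integral => p _; apply/esym/cvg_lim => //; exact: clip_kernel_cvg.
have {}cvgI := cvgI _ _.
rewrite -(cvg_lim _ (cvgI _))//; last first.
  by move=> p _ m n mn; rewrite lee_fin; exact: clip_kernel_nondecreasing.
apply: lime_le.
  by apply/cvg_ex; eexists; apply: cvgI => p _ m n mn; rewrite lee_fin; exact: clip_kernel_nondecreasing.
apply: nearW => n; apply: le_trans (hn n).
by rewrite (@fubini_tonelli1 _ _ _ _ _ mu mu _ (mclip n) (clip0 n)).
Qed.

(** The case of interest is an infinite integral, where additivity for integrable functions is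
    silent: the negative part of f + c is at most |c|, and its positive part is at least f - |c|. *)
Lemma integral_shift d (T : measurableType d) (mu : probability T R)
    (f : T -> \bar R) (c : R) : measurable_fun setT f -> (forall x, 0 <= f x)%E ->
  (\int[mu]_x (f x + c%:E) = \int[mu]_x f x + c%:E)%E.
Proof.
move=> mf f0; have ic : mu.-integrable setT (cst c%:E).
  exact: finite_measure_integrable_cst.
have intc : (\int[mu]_x cst c%:E x = c%:E)%E by rewrite integral_cst//= probability_setT mule1.
have [fy|foo] := eqVneq (\int[mu]_x f x)%E +oo%E; last first.
  have fi : mu.-integrable setT f.
    apply/integrableP; split=> //; rewrite lt_neqAle leey andbT.
    by under eq_integral do rewrite gee0_abs//.
  by rewrite (integralD measurableT fi ic) intc.
rewrite fy addye// integralE.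
have mg : measurable_fun setT (fun x => f x + c%:E)%E by apply: emeasurable_funD => //; exact: measurable_cst.
set g := (fun x => _) in mg *.
have gneg : (\int[mu]_x g^\- x <= `|c|%:E)%E.
  rewrite -[leRHS]mule1 -(@probability_setT _ _ _ mu) -(integral_cst mu measurableT).
  apply: ge0_le_integral => //=; first by apply: measurable_funeneg.
  move=> x _; rewrite funenegE ge_max; apply/andP; split; last by rewrite lee_fin.
  rewrite /g; case: (f x) (f0 x) => [r| |]//; last by rewrite /= leNye.
  by rewrite !lee_fin => r0; rewrite opprD -normrN; have := ler_norm (- c); lra.
have gpos : (\int[mu]_x g^\+ x = +oo)%E.
  apply/eqP; rewrite -leye_eq.
  have : (\int[mu]_x f x <= \int[mu]_x (g^\+ x + cst `|c|%:E x))%E.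
    apply: ge0_le_integral => //.
    - by apply: emeasurable_funD; [exact: measurable_funepos|exact: measurable_cst].
    - move=> x _; rewrite funeposE /g; case: (f x) (f0 x) => [r| |]//.
      rewrite -EFinD -EFin_max -EFinD !lee_fin => r0.
      by have := ler_norm (- c); rewrite normrN maxEle; case: ifP => ?; lra.
  rewrite ge0_integralD//; last 2 first.
  - exact: measurable_funepos.
  - by move=> x _; rewrite lee_fin.
  rewrite fy integral_cst//= probability_setT mule1.
  by rewrite !leye_eq; case: (\int[mu]_x g^\+ x)%E.
rewrite gpos; case: (\int[mu]_x g^\- x)%E gneg => //.
Qed.

(** Passes to a nonnegative kernel, for which Tonelli's theorem and monotone convergence are
    available. The kernels are matched only at distance at most [D], whence the almost everywhere
    equalities. *)
Lemma log_energy_shift (E : set (Cplane R)) (mu : probability (borelC R) R) :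
  compact E -> (forall z t, E z -> E t -> cmod (z - t) <= D) -> carried_by E mu ->
  (log_energy mu + (ln D)%:E = \int[mu]_z \int[mu]_t pos_kernel D z t)%E.
Proof.
move=> cE ED muE.
have mE : measurable (E : set (borelC R)) by exact: measurable_compactC.
have nE : mu.-negligible (~` E : set (borelC R)).
  by exists (~` E); split => //; exact: measurableC.
have -> : log_energy mu = (\int[mu]_z ((\int[mu]_t pos_kernel D z t) + (- ln D)%:E))%E.
  have sub z : E z -> (\int[mu]_t log_kernel z t)%E = ((\int[mu]_t pos_kernel D z t) + (- ln D)%:E)%E.
    move=> Ez; rewrite -integral_shift; last 2 first.
    - exact: measurable_pos_kernelr.
    - by move=> t; exact: pos_kernel_ge0.
    apply: ae_eq_integral => //.
    - exact: (measurableT_comp measurable_log_kernel (measurable_pairl z)).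
    - by apply: emeasurable_funD; [exact: measurable_pos_kernelr|exact: measurable_cst].
    - apply: negligibleS nE => t /= h Et; apply: h => _.
      by rewrite pos_kernel_log// ED.
  apply: ae_eq_integral => //.
  - exact: measurable_log_potential.
  - by apply: emeasurable_funD; [exact: measurable_potential|exact: measurable_cst].
  - by apply: negligibleS nE => z /= h Ez; apply: h => _; exact: sub.
rewrite integral_shift; last 2 first.
- exact: measurable_potential.
- by move=> z; apply: integral_ge0 => t _; exact: pos_kernel_ge0.
by rewrite -addeA -EFinD addNr adde0.
Qed.

End positive_kernel.

Section mixture.
Local Open Scope ereal_scope.
Context d (T : measurableType d) (R : realType).

Lemma ge0_integral_mrestr (mu : {measure set T -> \bar R}) (B : set T)
    (mB : measurable B) (f : T -> \bar R) :
  measurable_fun setT f -> (forall x, 0 <= f x) ->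
  \int[mrestr mu mB]_x f x = \int[mu]_(x in B) f x.
Proof.
move=> mf f0; have mC : measurable (~` B) by exact: measurableC.
have nB : mrestr mu mB (~` B) = 0 by rewrite /mrestr setICl measure0.
rewrite (ge0_negligible_integral _ _ _ _ nB)// setTD setCK.
by apply: eq_measure_integral => A mA AB; rewrite /= /mrestr; congr (mu _); exact/setIidl.
Qed.

(** The competitor for the first variation: mass is moved towards [B] while the total stays 1, and
    null sets of [mu] stay null, so the competitor is still carried by E. *)
Lemma mixture_probability (mu : probability T R) (B : set T) (s : R) :
  measurable B -> (0 <= s <= 1)%R ->
  exists nu : probability T R,
    (forall A, measurable A -> mu A = 0 -> nu A = 0) /\
    forall f : T -> \bar R, measurable_fun setT f -> (forall x, 0 <= f x) ->
      \int[nu]_x f x = (1 - s * fine (mu B))%:E * \int[mu]_x f x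
                       + s%:E * \int[mu]_(x in B) f x.
Proof.
move=> mB /andP[s0 s1].
have fB : mu B \is a fin_num by exact: fin_num_measure.
have b1 : (fine (mu B) <= 1)%R by rewrite -lee_fin fineK// probability_le1.
have b0 : (0 <= fine (mu B))%R by exact: fine_ge0.
have a0 : (0 <= 1 - s * fine (mu B))%R by rewrite subr_ge0 mulr_ile1.
pose m1 : {measure set T -> \bar R} := mscale (NngNum a0) mu.
pose m2 : {measure set T -> \bar R} := mscale (NngNum s0) (mrestr mu mB).
pose m : {measure set T -> \bar R} := measure_add m1 m2.
have mE A : m A = m1 A + m2 A by exact: measure_addE.
have m_1 : m setT = 1%E.
  rewrite (mE setT) /= /mscale/= /mrestr/= setTI probability_setT mule1.
  by rewrite -{2}(fineK fB) -EFinM -EFinD subrK.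
pose nu : probability T R := mnormalize m mu.
have nuE A : nu A = m A.
  by rewrite /nu/= /mnormalize m_1/= orbF gt_eqF// invr1 mule1.
exists nu; split.
  move=> A mA A0; rewrite nuE mE /= /mscale/= /mrestr/= A0 mule0 add0e.
  suff -> : mu (A `&` B) = 0 by rewrite mule0.
  apply/eqP; rewrite eq_le measure_ge0 andbT -A0; apply: le_measure; rewrite ?inE//.
  exact: measurableI.
move=> f mf f0.
have -> : \int[nu]_x f x = \int[m]_x f x by apply: eq_measure_integral => A _ _; exact: nuE.
rewrite ge0_integral_measure_add// !ge0_integral_mscale//=.
by rewrite ge0_integral_mrestr.
Qed.

End mixture.

(** * First variation of the energy and the potential of the equilibrium measure *)

Section equilibrium.
Context {R : realType}.
Variable E : set (Cplane R).
Hypothesis mE : measurable (E : set (borelC R)).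
Variables (D w : R) (mu : probability (borelC R) R).
Hypothesis D1 : 1 <= D.
Hypothesis ED : forall z t, E z -> E t -> cmod (z - t) <= D.
Hypothesis muE : carried_by E mu.
Hypothesis muw : (\int[mu]_z \int[mu]_t pos_kernel D z t = w%:E)%E.
Hypothesis wmin : forall nu : probability (borelC R) R, carried_by E nu ->
  (w%:E <= \int[nu]_z \int[nu]_t pos_kernel D z t)%E.

Let U (z : Cplane R) : \bar R := (\int[mu]_t pos_kernel D z t)%E.

Let U0 z : (0 <= U z)%E.
Proof. by apply: integral_ge0 => t _; exact: pos_kernel_ge0. Qed.

Let mU : measurable_fun setT (U : borelC R -> \bar R).
Proof. exact: measurable_potential. Qed.

Let w0 : 0 <= w.
Proof. by rewrite -lee_fin -muw; apply: integral_ge0 => z _; exact: U0. Qed.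

Let mB0 (B : set (borelC R)) : measurable B ->
  measurable_fun setT (fun p : borelC R * borelC R =>
    ((fun p => pos_kernel D p.1 p.2) \_ (setT `*` B)) p).
Proof.
move=> mB; apply/(measurable_restrictT _ _).1.
  exact: measurableX.
by apply: measurable_funTS; exact: measurable_pos_kernel.
Qed.

Let restrictX (B : set (borelC R)) z t :
  ((fun p : borelC R * borelC R => pos_kernel D p.1 p.2) \_ (setT `*` B)) (z, t) =
  ((fun t => pos_kernel D z t) \_ B) t.
Proof.
rewrite /patch; have [zt|zt] := boolP ((z, t) \in setT `*` B).
  by move/set_mem: zt => [_ Bt]; rewrite mem_set.
case: ifPn => // /set_mem Bt; move/negP: zt => []; exact: mem_set.
Qed.

Let restrict0 (B : set (borelC R)) p :
  (0 <= ((fun p : borelC R * borelC R => pos_kernel D p.1 p.2) \_ (setT `*` B)) p)%E.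
Proof. by apply: erestrict_ge0 => q _; exact: pos_kernel_ge0. Qed.

Let UB (B : set (borelC R)) (z : Cplane R) : \bar R := (\int[mu]_(t in B) pos_kernel D z t)%E.

Let UB0 B z : (0 <= UB B z)%E.
Proof. by apply: integral_ge0 => t _; exact: pos_kernel_ge0. Qed.

Let mUB B : measurable B -> measurable_fun setT (UB B : borelC R -> \bar R).
Proof.
move=> mB; have := measurable_fun_fubini_tonelli_F _ (mB0 mB) (restrict0 B) (m2 := mu).
congr (measurable_fun _ _); apply/funext => z.
by rewrite /UB integral_mkcond /fubini_F; apply: eq_integral => t _; rewrite restrictX.
Qed.

Let integral_UB B : measurable B -> (\int[mu]_z UB B z = \int[mu]_(z in B) U z)%E.
Proof.
move=> mB; have := fubini_tonelli _ (mB0 mB) (restrict0 B) (m1 := mu) (m2 := mu).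
move=> h; rewrite [RHS]integral_mkcond; apply: etrans (etrans h _).
  apply: eq_integral => z _; rewrite /UB integral_mkcond.
  by apply: eq_integral => t _; rewrite restrictX.
apply: eq_integral => t _; under eq_integral do rewrite restrictX.
rewrite /patch; case: ifPn => tB; last by rewrite integral0.
by apply: eq_integral => z _; rewrite pos_kernelC.
Qed.

(** The energy of the mixture is a quadratic polynomial in s on [0, 1], minimal at s = 0; the claim
    says that its derivative there is nonnegative. *)
Lemma first_variation B : measurable B ->
  (w%:E * mu B <= \int[mu]_(z in B) U z)%E.
Proof.
move=> mB.
have Jw : (\int[mu]_(z in B) U z <= w%:E)%E.
  by rewrite -muw; apply: ge0_subset_integral => //; exact: measurableT.
have Jfin : (\int[mu]_(z in B) U z)%E \is a fin_num.
  rewrite ge0_fin_numE; first exact: le_lt_trans Jw (ltry _).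
  by apply: integral_ge0 => z _; exact: U0.
have bfin : mu B \is a fin_num by exact: fin_num_measure.
set b := fine (mu B); set J := fine (\int[mu]_(z in B) U z)%E.
have JE : (\int[mu]_(z in B) U z = J%:E)%E by rewrite fineK.
have J0 : 0 <= J by apply: fine_ge0; apply: integral_ge0 => z _; exact: U0.
have b01 : 0 <= b <= 1.
  by rewrite fine_ge0//= -lee_fin fineK// probability_le1.
rewrite JE -(fineK bfin) -EFinM lee_fin -/b.
(* After division by s the quadratic remainder is s (b^2 w - 2 b J + q), with q the mutual energy of
   [mu] restricted to [B]. It is at most 2 s w, as q <= J <= w and b <= 1. *)
have key s : 0 < s -> s <= 1 -> w * b <= J + s * w.
  move=> s0 s1; have s01 : 0 <= s <= 1 by rewrite (ltW s0).
  have [nu [nu0 nuint]] := mixture_probability mu mB s01.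
  have nuE : carried_by E nu by apply: nu0 => //; exact: measurableC.
  have /andP[b0 b1] := b01.
  have a0 : 0 <= 1 - s * b by rewrite subr_ge0 mulr_ile1// ltW.
  have inner z : (\int[nu]_t pos_kernel D z t = (1 - s * b)%:E * U z + s%:E * UB B z)%E.
    by apply: nuint; [exact: measurable_pos_kernelr|move=> t; exact: pos_kernel_ge0].
  have := wmin nuE; under eq_integral do rewrite inner.
  have maU : measurable_fun setT (fun z : borelC R => (1 - s * b)%:E * U z)%E.
    exact: measurable_funeM.
  have msU : measurable_fun setT (fun z : borelC R => s%:E * UB B z)%E.
    by apply: measurable_funeM; exact: mUB.
  have aU0 z : (0 <= (1 - s * b)%:E * U z)%E by rewrite mule_ge0 ?lee_fin.
  have sU0 z : (0 <= s%:E * UB B z)%E by rewrite mule_ge0 ?lee_fin// ltW.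
  rewrite nuint; last 2 first.
  - exact: emeasurable_funD.
  - by move=> z; rewrite adde_ge0.
  rewrite !ge0_integralD//; do ?exact: measurable_funTS.
  rewrite !ge0_integralZl//; do ?[exact: mUB | exact: measurable_funTS | exact/measurable_funTS/mUB | by rewrite lee_fin ltW].
  rewrite (integral_UB mB) muw JE -/b.
  have : (\int[mu]_(z in B) UB B z <= J%:E)%E.
    rewrite -JE; apply: ge0_le_integral => //.
    - by apply: measurable_funTS; exact: mUB.
    - exact: measurable_funTS.
    - move=> z _; apply: ge0_subset_integral => //; first exact: measurable_pos_kernelr.
      by move=> t _; exact: pos_kernel_ge0.
  have : (0 <= \int[mu]_(z in B) UB B z)%E by apply: integral_ge0 => z _; exact: UB0.
  move: Jw; rewrite JE lee_fin => Jw'.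
  case: (\int[mu]_(z in B) UB B z)%E => [q| |]//; rewrite !lee_fin => q0 qJ.
  have h1 : b ^+ 2 * w <= w by rewrite ler_piMl// exprn_ile1.
  have h2 : 0 <= b * J by exact: mulr_ge0.
  move=> h3.
  have h4 : s * (2 * (w * b)) <= s * (2 * J + s * (b ^+ 2 * w - 2 * (b * J) + q)).
    by rewrite -subr_ge0; move: h3; rewrite -subr_ge0; congr (0 <= _); ring.
  move: h4; rewrite ler_pM2l// => h4.
  have h5 : s * (b ^+ 2 * w - 2 * (b * J) + q) <= s * (2 * w).
    by rewrite ler_pM2l//; lra.
  by lra.
  by apply: measurable_funTS; exact: mUB.
apply/ler_addgt0Pr => e e0.
pose s := Num.min 1 (e / (w + 1)).
have w1 : 0 < w + 1 by rewrite ltr_wpDl.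
have s0 : 0 < s by rewrite lt_min ltr01 divr_gt0.
apply: (le_trans (key s s0 _)); first by rewrite ge_min lexx.
rewrite lerD2l; apply: (@le_trans _ _ (e / (w + 1) * w)).
  by rewrite ler_wpM2r// ge_min lexx orbT.
by rewrite mulrAC ler_pdivrMr// ler_pM2l//; lra.
Qed.

(* The potential is at least w in mean on {U <= w}, so {U > w} is negligible. *)
Lemma potential_ae_le : mu [set z | (w%:E < U z)%E] = 0%E.
Proof.
have mA c : measurable ([set z | (c%:E < U z)%E] : set (borelC R)).
  have := measurable_lte measurableT (measurable_cst (c%:E : \bar R)) mU.
  by rewrite setTI.
have null c : w < c -> mu [set z | (c%:E < U z)%E] = 0%E.
  move=> wc; pose A : set (borelC R) := [set z | (c%:E < U z)%E]; rewrite -/A.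
  have mAC : measurable (~` A) by apply: measurableC; exact: mA.
  have fA : mu A \is a fin_num by apply: fin_num_measure; exact: mA.
  have h1 := first_variation mAC.
  have h2 : (c%:E * mu A <= \int[mu]_(z in A) U z)%E.
    rewrite -integral_cst; last exact: mA.
    apply: ge0_le_integral => //; first exact: mA.
    - by move=> z _; rewrite lee_fin (le_trans w0)// ltW.
    - exact: measurable_funTS.
    - by move=> z /ltW.
  have : (\int[mu]_(z in A) U z + \int[mu]_(z in ~` A) U z = w%:E)%E.
    rewrite -(ge0_integral_setU mu (mA c) mAC) ?setUCr ?muw//.
    by rewrite disj_set2E setICr.
  move=> h3; have := leeD h2 h1; rewrite h3 probability_setC; last exact: mA.
  have : (0 <= mu A)%E by exact: measure_ge0.
  move: fA; case: (mu A) => [a| |]// _; rewrite lee_fin => a0.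
  rewrite -EFinB -!EFinM -EFinD lee_fin => h4; congr (_%:E).
  have : (c - w) * a <= 0 by lra.
  by rewrite pmulr_rle0 ?subr_gt0// => a0'; apply/le_anti; rewrite a0 a0'.
have sub : ([set z | (w%:E < U z)%E] : set (borelC R)) `<=`
    \bigcup_n ([set z | ((w + n.+1%:R^-1)%:E < U z)%E] : set (borelC R)).
  move=> z /=; case Uz: (U z) => [u| |]// wu; last by exists 0%N; rewrite //= Uz ltry.
  exists (Num.truncn (u - w)^-1); rewrite //= Uz; move: wu; rewrite !lte_fin => wu.
  rewrite -ltrBrDl -[ltRHS]invrK ltf_pV2 ?posrE ?invr_gt0 ?subr_gt0//.
  exact: truncnS_gt.
apply/negligibleP; first exact: mA.
apply: (negligibleS sub); apply: negligible_bigcup => n.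
by apply/negligibleP; [exact: mA|apply: null; rewrite ltrDl invr_gt0].
Qed.

Definition good_set : set (Cplane R) :=
  [set z | E z /\ (\int[mu]_t pos_kernel D z t <= w%:E)%E].

Lemma measurable_good_set : measurable (good_set : set (borelC R)).
Proof.
apply: measurableI => //.
have := measurable_lte measurableT (measurable_cst (w%:E : \bar R)) mU.
rewrite setTI => /measurableC; congr measurable.
by apply/seteqP; split=> z /=; rewrite leNgt => /negP.
Qed.

Lemma good_set_full : mu (good_set : set (borelC R)) = 1%E.
Proof.
have mG := measurable_good_set.
have : mu (~` (good_set : set (borelC R))) = 0%E.
  apply/negligibleP; first exact: measurableC.
  have nE : mu.-negligible (~` E : set (borelC R)).
    by exists (~` E); split => //; exact: measurableC.
  have nU : mu.-negligible ([set z | (w%:E < U z)%E] : set (borelC R)).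
    apply/negligibleP; last exact: potential_ae_le.
    have := measurable_lte measurableT (measurable_cst (w%:E : \bar R)) mU.
    by rewrite setTI.
  apply: negligibleS (negligibleU nE nU) => z /= h.
  have [Ez|] := pselect (E z); last by left.
  by right; rewrite ltNge; apply/negP => Uz; apply: h.
rewrite probability_setC//.
have : mu good_set \is a fin_num by exact: fin_num_measure.
case: (mu good_set) => [g| |]// _; rewrite -EFinB => -[/eqP].
by rewrite subr_eq0 => /eqP <-.
Qed.

(* Averaging the left-hand side over mu gives at most the right-hand side. *)
Lemma averaging_point (f : Cplane R -> R) (B a : R) (s : seq (Cplane R)) :
  measurable_fun setT (f : borelC R -> R) -> (forall z, `|f z| <= B) ->
  (forall x, x \in s -> good_set x) ->
  exists z, [/\ good_set z, z \notin s &
    \sum_(x <- s) - ln (cmod (z - x)) + a * f z <=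
      (size s)%:R * (w - ln D) + a * (\int[mu]_z f z) + 1].
Proof.
move=> mf fB sG; apply: contrapT => h.
have B0 : 0 <= B by rewrite (le_trans _ (fB 0)).
(* An upper bound for the mean of [G] below; the shift by |a| B makes the integrand nonnegative. *)
pose c := (size s)%:R * w + a * (\int[mu]_z f z) + `|a| * B.
pose g z := a * f z + `|a| * B.
have g0 z : 0 <= g z.
  have h1 : `|a * f z| <= `|a| * B by rewrite normrM ler_wpM2l.
  by move: h1; rewrite ler_norml /g => /andP[h1 _]; lra.
have mg : measurable_fun setT (g : borelC R -> R).
  by apply: measurable_funD; [exact: measurable_funM|exact: measurable_cst].
have intg : (\int[mu]_z (g z)%:E = (a * (\int[mu]_z f z) + `|a| * B)%:E)%E.
  have fi : mu.-integrable setT (EFin \o (f : borelC R -> R)).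
    apply: measurable_bounded_integrable => //.
      by rewrite /= probability_setT ltry.
    exists B; split; first exact: num_real.
    by move=> x Bx z _ /=; rewrite (le_trans (fB z))// ltW.
  have ic : mu.-integrable setT (cst (`|a| * B)%:E) by exact: finite_measure_integrable_cst.
  have -> : (fun z => (g z)%:E) = (fun z => a%:E * (EFin \o f) z + cst (`|a| * B)%:E z)%E.
    by apply/funext => z.
  rewrite integralD//; last exact: integrableZl.
  rewrite integralZl// integral_cst//= probability_setT mule1.
  by rewrite /Rintegral EFinD (EFinM a) fineK//; exact: integrable_fin_num.
pose G z : \bar R := (\sum_(x <- s) pos_kernel D x z + (g z)%:E)%E.
have mS : measurable_fun setT (fun z : borelC R => \sum_(x <- s) pos_kernel D x z)%E.
  by apply: emeasurable_sum => x; exact: measurable_pos_kernelr.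
have S0 z : (0 <= \sum_(x <- s) pos_kernel D x z)%E.
  by apply: sume_ge0 => x _; exact: pos_kernel_ge0.
have mG : measurable_fun setT (G : borelC R -> \bar R).
  by apply: emeasurable_funD => //; exact/measurable_EFinP.
have G0 z : (0 <= G z)%E by rewrite adde_ge0 ?lee_fin.
have GK z : good_set z -> ((c + 1)%:E <= G z)%E.
  (* The kernel is infinite at the points of [s], so a point where [G] is small automatically avoids
     [s]. *)
  move=> gz; have [zs|zs] := boolP (z \in s).
    have hz : pos_kernel D z z = +oo%E by rewrite /pos_kernel subrr cmod0 eqxx.
    have hs : (0 <= \sum_(x <- rem z s) pos_kernel D x z)%E.
      by apply: sume_ge0 => x _; exact: pos_kernel_ge0.
    rewrite /G (big_rem z)//= hz addye ?addye ?leey//.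
    by rewrite -ltNye (lt_le_trans _ hs).
  have -> : G z = (\sum_(x <- s) (ln D - ln (cmod (z - x))) + g z)%:E.
    rewrite EFinD -sumEFin; congr (_ + _)%E; apply: eq_big_seq => x xs.
    rewrite pos_kernelC pos_kernel_fin//.
      rewrite lt0r cmod_ge0 andbT cmod_eq0 subr_eq0; apply/eqP => zx.
      by move: zs; rewrite zx xs.
    by apply: ED; [exact: gz.1|exact: (sG x xs).1].
  rewrite lee_fin leNgt; apply/negP => hlt; apply: h; exists z; split=> //.
  move: hlt; rewrite big_split/= big_const_seq count_predT iter_addr_0 -mulr_natl /g /c.
  move: (\sum_(x <- s) _) (\int[mu]_z f z) => S F; lra.
have : (\int[mu]_z G z <= c%:E)%E.
  have mge : measurable_fun setT (fun z : borelC R => (g z)%:E) by exact/measurable_EFinP.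
  have g0e z : setT z -> (0 <= (g z)%:E)%E by rewrite lee_fin.
  rewrite (ge0_integralD mu measurableT (fun z _ => S0 z) mS g0e mge).
  rewrite intg ge0_integral_sum//; last 2 first.
  - by move=> x; exact: measurable_pos_kernelr.
  - by move=> x z _; exact: pos_kernel_ge0.
  rewrite /c -addrA [leRHS]EFinD; apply: leeD => //.
  rewrite big_seq; apply: (@le_trans _ _ (\sum_(x <- s | x \in s) w%:E)%E).
    by apply: lee_sum => x /sG[].
  by rewrite -big_seq sumEFin big_const_seq count_predT iter_addr_0 -(mulr_natl w).
move=> Gc; have c0 : 0 <= c.
  by rewrite -lee_fin; apply: le_trans Gc; apply: integral_ge0 => z _.
move: Gc; apply/negP; rewrite -ltNge.
apply: (@lt_le_trans _ _ (c + 1)%:E); first by rewrite lte_fin ltrDl.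
rewrite -[leLHS]mule1 -good_set_full -integral_cst; last exact: measurable_good_set.
apply: (@le_trans _ _ (\int[mu]_(z in good_set) G z)%E).
  apply: ge0_le_integral => //; first exact: measurable_good_set.
  - by move=> z _; rewrite lee_fin addr_ge0.
  - exact: measurable_funTS.
apply: ge0_subset_integral => //; exact: measurable_good_set.
Qed.

End equilibrium.

(** * Almost minimizing point configurations *)

Section near_minimizers.
Context {R : realType}.
Variables (E K : set (Cplane R)) (f : Cplane R -> R) (D B v F : R).
Hypothesis KE : K `<=` E.
Hypothesis ED : forall z t, E z -> E t -> cmod (z - t) <= D.
Hypothesis fB : forall z, `|f z| <= B.
Hypothesis FB : `|F| <= B.
Hypothesis energy_ge : forall e : R, 0 < e -> exists N : nat,
  forall n (x : 'I_n -> Cplane R), (N <= n)%N -> injective x ->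
    (forall i, E (x i)) -> n%:R * n.-1%:R * (v - e) <= discrete_energy x.
Hypothesis averaging : forall (a : R) (s : seq (Cplane R)),
  (forall x, x \in s -> K x) -> exists z, [/\ K z, z \notin s &
    \sum_(x <- s) - ln (cmod (z - x)) + a * f z <= (size s)%:R * v + a * F + 1].

(** Moving one point changes the discrete energy by twice a sum over the n-1 other points. The
    factor of f matches this, so that after halving f enters with weight a (n-1). *)
Definition tilted_energy (a : R) n (x : 'I_n -> Cplane R) : R :=
  discrete_energy x + 2 * a * n.-1%:R * \sum_(i < n) f (x i).

Lemma discrete_energyD1 n (x : 'I_n -> Cplane R) i :
  discrete_energy x = 2 * \sum_(k < n | k != i) - ln (cmod (x i - x k)) +
    \sum_(j < n | j != i) \sum_(k < n | (k != j) && (k != i)) - ln (cmod (x j - x k)).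
Proof.
rewrite /discrete_energy (bigD1 i)//= mulr_natl mulr2n -addrA; congr (_ + _).
rewrite -big_split/=; apply: eq_bigr => j ji.
by rewrite (bigD1 i) 1?eq_sym//= cmodB.
Qed.

Lemma exists_distinct n : exists x : 'I_n -> Cplane R, injective x /\ forall i, K (x i).
Proof.
have [s [us sn sK]] : exists s : seq (Cplane R), [/\ uniq s, size s = n & forall x, x \in s -> K x].
  elim: n => [|n [s [us sn sK]]]; first by exists [::].
  have [z [Kz zs _]] := averaging 0 sK.
  exists (z :: s); rewrite /= zs us sn; split=> // x.
  by rewrite in_cons => /orP[/eqP->//|]; exact: sK.
exists (fun i => nth 0 s i); split=> [i j /eqP|i].
  by rewrite nth_uniq ?sn// => /eqP/val_inj.
by apply: sK; rewrite mem_nth ?sn.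
Qed.

(** Distinctness of the points, and [A] that need not be closed, may keep the infimum from being
    attained; a slack of 1 is negligible against n^2. [A] is [K] when points are compared with
    averages over the measure, and [E] when control at all points of E is wanted. *)
Lemma near_minimizer (A : set (Cplane R)) (a : R) n : K `<=` A -> A `<=` E ->
  exists x : 'I_n -> Cplane R, [/\ injective x, (forall i, A (x i)) &
    forall y : 'I_n -> Cplane R, injective y -> (forall i, A (y i)) ->
      tilted_energy a x <= tilted_energy a y + 1].
Proof.
move=> KA AE.
pose S := [set h | exists x : 'I_n -> Cplane R,
  [/\ injective x, (forall i, A (x i)) & h = tilted_energy a x]].
have lbS : has_lbound S.
  exists (\sum_(i < n) \sum_(k < n | k != i) - ln D - `|2 * a * n.-1%:R| * (n%:R * B)).
  move=> _ [x [xi xA ->]]; apply: lerD.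
    apply: ler_sum => i _; apply: ler_sum => k ki; rewrite lerN2.
    have xik : 0 < cmod (x i - x k).
      by rewrite lt0r cmod_ge0 andbT cmod_eq0 subr_eq0 (inj_eq xi) eq_sym.
    have xD : cmod (x i - x k) <= D by apply: ED; apply: AE.
    by rewrite ler_ln ?posrE//; exact: lt_le_trans xD.
  have : `|2 * a * n.-1%:R * \sum_(i < n) f (x i)| <= `|2 * a * n.-1%:R| * (n%:R * B).
    rewrite normrM ler_wpM2l// (le_trans (ler_norm_sum _ _ _))//.
    rewrite mulr_natl -[X in _ *+ X]card_ord -sumr_const.
    by apply: ler_sum => i _; exact: fB.
  by rewrite ler_norml => /andP[].
have S0 : S !=set0.
  have [x [xi xK]] := exists_distinct n.
  by exists (tilted_energy a x), x; split=> // i; exact: KA.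
have [_ [x [xi xA ->]] hx] := inf_adherent ltr01 (conj S0 lbS).
exists x; split=> // y yi yA; apply: (le_trans (ltW hx)); rewrite lerD2r.
by apply: ge_inf => //; exists y.
Qed.

(* Compare x with the configuration in which its i-th point is moved to z. *)
Lemma near_minimizer_exchange (A : set (Cplane R)) (a : R) n (x : 'I_n -> Cplane R) i z :
  injective x -> (forall i, A (x i)) ->
  (forall y : 'I_n -> Cplane R, injective y -> (forall i, A (y i)) ->
      tilted_energy a x <= tilted_energy a y + 1) ->
  A z -> (forall k, k != i -> z != x k) ->
  \sum_(k < n | k != i) - ln (cmod (x i - x k)) + a * n.-1%:R * f (x i) <=
  \sum_(k < n | k != i) - ln (cmod (z - x k)) + a * n.-1%:R * f z + 1 / 2.
Proof.
move=> xi xA hx Az zx; pose y k := if k == i then z else x k.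
have yx k : k != i -> y k = x k by rewrite /y => /negbTE->.
have yi : injective y.
  move=> j k; rewrite /y; case: (eqVneq j i) => [->|ji]; case: (eqVneq k i) => [->|ki]//.
  - by move/eqP; rewrite (negbTE (zx _ ki)).
  - by move/eqP; rewrite eq_sym (negbTE (zx _ ji)).
  - exact: xi.
have yA k : A (y k) by rewrite /y; case: ifP.
have := hx y yi yA; rewrite /tilted_energy !(@discrete_energyD1 _ _ i).
rewrite [X in _ -> _ <= X + _ + _](_ : _ = \sum_(k < n | k != i) - ln (cmod (y i - y k))); last first.
  by apply: eq_bigr => k ki; rewrite (yx k ki) /y eqxx.
have yii : y i = z by rewrite /y eqxx.
rewrite [\sum_(j < n) f (x j)](bigD1 i)//= [\sum_(j < n) f (y j)](bigD1 i)//= yii.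
have -> : \sum_(j < n | j != i) f (y j) = \sum_(j < n | j != i) f (x j).
  by apply: eq_bigr => j ji; rewrite yx.
have -> : \sum_(j < n | j != i) \sum_(k < n | (k != j) && (k != i)) - ln (cmod (y j - y k)) =
    \sum_(j < n | j != i) \sum_(k < n | (k != j) && (k != i)) - ln (cmod (x j - x k)).
  apply: eq_bigr => j ji; apply: eq_bigr => k /andP[_ ki].
  by rewrite (yx j ji) (yx k ki).
set Sx := \sum_(k < n | _) _; set T := \sum_(j < n | _) _; set Sy := \sum_(k < n | _) _.
set G := \sum_(j < n | _) _; move: (n.-1%:R : R) => N; lra.
Qed.

Lemma tilted_points (a : R) n : exists x : 'I_n -> Cplane R,
  [/\ injective x, (forall i, K (x i)) & forall i,
    \sum_(k < n | k != i) - ln (cmod (x i - x k)) + a * n.-1%:R * f (x i) <=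
    n.-1%:R * (v + a * F) + 2].
Proof.
have [x [xi xK hx]] := @near_minimizer K a n (@subset_refl _ K) KE.
exists x; split=> // i.
pose s := [seq x k | k <- enum [pred k | k != i]].
have ss : size s = n.-1 by rewrite size_map -cardE cardC1 card_ord.
have [|z [Kz zs hz]] := @averaging (a * n.-1%:R) s.
  by move=> _ /mapP[k _ ->].
have zx k : k != i -> z != x k.
  move=> ki; apply: contraNneq zs => ->; apply: map_f.
  by rewrite mem_enum inE.
apply: (le_trans (near_minimizer_exchange xi xK hx Kz zx)).
move: hz; rewrite ss big_map big_enum/=; move: (n.-1%:R : R) => N; lra.
Qed.

Let B0 : 0 <= B. Proof. by rewrite (le_trans _ (fB 0)). Qed.

Let large_nat (C : R) : exists N : nat, forall n, (N <= n)%N -> C <= n.-1%:R.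
Proof.
exists (Num.truncn C).+2 => n Nn; apply/ltW; apply: lt_le_trans (truncnS_gt _) _.
by rewrite ler_nat; case: n Nn.
Qed.

Let sum_tilted (a : R) n (x : 'I_n -> Cplane R) :
  (forall i, \sum_(k < n | k != i) - ln (cmod (x i - x k)) + a * n.-1%:R * f (x i) <=
    n.-1%:R * (v + a * F) + 2) ->
  discrete_energy x + a * n.-1%:R * \sum_(i < n) f (x i) <=
    n%:R * (n.-1%:R * (v + a * F) + 2).
Proof.
move=> h; have -> : n%:R * (n.-1%:R * (v + a * F) + 2) =
    \sum_(i < n) (n.-1%:R * (v + a * F) + 2).
  by rewrite sumr_const card_ord mulr_natl.
by rewrite /discrete_energy mulr_sumr -big_split/=; apply: ler_sum => i _; exact: h.
Qed.

Lemma equidistributed_points (e : R) : 0 < e -> exists N : nat, forall n, (N <= n)%N ->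
  exists x : 'I_n -> Cplane R, [/\ injective x, (forall i, E (x i)),
    (forall i, \sum_(k < n | k != i) - ln (cmod (x i - x k)) <= n.-1%:R * (v + e)) &
    \sum_(i < n) f (x i) <= n%:R * (F + e)].
Proof.
(* Small enough for the tilt to shift each sum by at most (n-1) e/2. With energy tolerance a e/2,
   division by a (n-1) leaves an error e/2 in the mean of f; the thresholds for n absorb the
   additive constants 2. *)
move=> e0; pose a := e / (4 * (B + 1)).
have a0 : 0 < a by rewrite divr_gt0// mulr_gt0// ltr_wpDl.
have ae0 : 0 < a * e / 2 by rewrite divr_gt0// mulr_gt0.
have aB : 2 * a * B <= e / 2.
  have -> : a = (e / 4) * (B + 1)^-1 by rewrite /a invfM mulrA.
  have h1 : (B + 1)^-1 * B <= 1 by rewrite mulrC ler_pdivrMr ?mul1r ?lerDl// ltr_wpDl.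
  have e4 : 0 <= e / 2 by rewrite ltW// divr_gt0.
  have := ler_wpM2l e4 h1; rewrite mulr1; lra.
have [N1 hN1] := energy_ge ae0.
have [N2 hN2] := large_nat (4 / e).
have [N3 hN3] := large_nat (4 / (a * e)).
exists (maxn N1 (maxn N2 N3)) => n; rewrite !geq_max => /and3P[n1 n2 n3].
have [x [xi xK hx]] := tilted_points a n.
have xE i : E (x i) by exact: KE.
have := hN2 n n2; rewrite ler_pdivrMr// => h2.
have := hN3 n n3; rewrite (ler_pdivrMr _ _ (mulr_gt0 a0 e0)) => h3.
exists x; split=> // [i|].
  have := hx i; have /andP[f1 f2] : - B <= f (x i) <= B by rewrite -ler_norml.
  have /andP[F1 F2] : - B <= F <= B by rewrite -ler_norml.
  have m0 : 0 <= n.-1%:R :> R by [].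
  have : a * n.-1%:R * (F - f (x i)) <= a * n.-1%:R * (2 * B).
    apply: ler_wpM2l; first exact: mulr_ge0 (ltW a0) m0.
    by lra.
  have : n.-1%:R * (2 * a * B) <= n.-1%:R * (e / 2) by rewrite ler_wpM2l.
  move: h2 m0; move: (n.-1%:R : R) (f (x i)) (\sum_(k < n | _) _) => m fi S; lra.
have := sum_tilted hx; have := hN1 n x n1 xi xE.
have n0' : 0 <= n%:R :> R by [].
have h4 : n%:R * 4 <= n%:R * (n.-1%:R * (a * e)) by rewrite ler_wpM2l.
have [m0|m0] := ltP 0 (n.-1%:R : R); last first.
  by exfalso; move: h3; apply/negP; rewrite -ltNge (le_lt_trans (_ : _ <= 0))// mulr_le0_ge0// mulr_ge0// ltW.
move=> h5 h6; have am : 0 < a * n.-1%:R by rewrite mulr_gt0.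
rewrite -(ler_pM2l am); move: h4 h5 h6.
move: (n.-1%:R : R) (n%:R : R) (discrete_energy x) (\sum_(i < n) f (x i)) => m k DE S; lra.
Qed.

(** The sum at z is minus the logarithm of a monic polynomial with roots x_k, k != i. Minimizing
    over all of E lets the exchange reach every z in E, while the mean of f comes from comparison
    with points [y] of [K], whose tilted energy is at most about n^2 (v - 2 a F). *)
Lemma extremal_points (e : R) : 0 < e -> exists n (x : 'I_n.+2 -> Cplane R) (i : 'I_n.+2),
  [/\ forall k, E (x k), forall z, E z -> (forall k, k != i -> z != x k) ->
     n.+1%:R * (v - e) <= \sum_(k < n.+2 | k != i) - ln (cmod (z - x k)) &
  n.+1%:R * (F - e) <= \sum_(k < n.+2 | k != i) f (x k)].
Proof.
move=> e0; pose a := e / (8 * (B + 1)).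
have a0 : 0 < a by rewrite divr_gt0// mulr_gt0// ltr_wpDl.
have ae0 : 0 < a * e / 4 by rewrite divr_gt0// mulr_gt0.
have B1 : 1 <= B + 1 by rewrite lerDr.
have aB : 2 * a * B <= e / 4.
  have -> : a = (e / 8) * (B + 1)^-1 by rewrite /a invfM mulrA.
  have h1 : (B + 1)^-1 * B <= 1 by rewrite mulrC ler_pdivrMr ?mul1r ?lerDl// ltr_wpDl.
  have e4 : 0 <= e / 4 by rewrite ltW// divr_gt0.
  have := ler_wpM2l e4 h1; rewrite mulr1; lra.
pose eps := Num.min (a * e / 4) (e / 4).
have eps0 : 0 < eps by rewrite lt_min ae0 divr_gt0.
have eps1 : eps <= a * e / 4 by rewrite ge_min lexx.
have eps2 : eps <= e / 4 by rewrite ge_min lexx orbT.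
have [N1 hN1] := energy_ge eps0.
have [N2 hN2] := large_nat (2 / e).
(* With m = n+1, the lower-order losses sum to at most m (9 + 4 a B) / 2: 2 a B m for deleting
   f(x_i) and for passing from n+2 to n+1 copies of F, the rest for the slacks. *)
have [N3 hN3] := large_nat ((9 + 4 * a * B) / (a * e)).
pose n := maxn N1 (maxn N2 N3).
have [n1 n2 n3] : [/\ (N1 <= n.+2)%N, (N2 <= n.+2)%N & (N3 <= n.+2)%N].
  by split; do 2 apply: leqW; rewrite !leq_max leqnn ?orbT.
have := hN2 _ n2; rewrite ler_pdivrMr// => h2.
have := hN3 _ n3; rewrite (ler_pdivrMr _ _ (mulr_gt0 a0 e0)) => h3.
have [y [yi yK hy]] := tilted_points (- a) n.+2.
have [x [xi xE hx]] := @near_minimizer E (- a) n.+2 KE (@subset_refl _ E).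
have T1 := sum_tilted hy.
have T2 := hN1 _ y n1 yi (fun i => KE (yK i)).
have T3 := hx y yi (fun i => KE (yK i)).
have T4 := hN1 _ x n1 xi xE.
(* Some point has at least the mean sum, which the energy bound controls from below; exchanging this
   point for z transfers the bound to z. *)
have [i hi] : exists i, n.+1%:R * (v - eps) <= \sum_(k < n.+2 | k != i) - ln (cmod (x i - x k)).
  apply: contrapT => hi; move: T4; apply/negP; rewrite -ltNge /discrete_energy -mulrA.
  have -> : n.+2%:R * (n.+2.-1%:R * (v - eps)) = \sum_(i < n.+2) (n.+1%:R * (v - eps)).
    by rewrite sumr_const card_ord mulr_natl.
  have hlt i : \sum_(k < n.+2 | k != i) - ln (cmod (x i - x k)) < n.+1%:R * (v - eps).
    by rewrite ltNge; apply/negP => h; apply: hi; exists i.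
  rewrite !big_ord_recl; apply: ltr_leD; first exact: hlt.
  by apply: lerD; [exact/ltW/hlt|apply: ler_sum => j _; exact/ltW/hlt].
rewrite /= in h2 h3 T1 T2 T3 T4.
have m0 : 0 <= n.+1%:R :> R by [].
have m1 : 1 <= n.+1%:R :> R by rewrite ler1n.
exists n, x, i; split => //.
  move=> z Ez zx.
  have := near_minimizer_exchange xi xE hx Ez zx; rewrite /=.
  have /andP[f1 f2] : - B <= f (x i) <= B by rewrite -ler_norml.
  have /andP[g1 g2] : - B <= f z <= B by rewrite -ler_norml.
  have : a * n.+1%:R * (f z - f (x i)) >= a * n.+1%:R * (- (2 * B)).
    by apply: ler_wpM2l; [exact: mulr_ge0 (ltW a0) m0|lra].
  have : n.+1%:R * (2 * a * B) <= n.+1%:R * (e / 4) by rewrite ler_wpM2l.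
  have : n.+1%:R * eps <= n.+1%:R * (e / 4) by rewrite ler_wpM2l.
  move: hi h2; move: (\sum_(k < n.+2 | k != i) - ln (cmod (x i - x k)))
    (\sum_(k < n.+2 | k != i) - ln (cmod (z - x k))) => S1 S2.
  move: (n.+1%:R : R) (f z) (f (x i)) => m fz fx; lra.
have Sx : \sum_(k < n.+2) f (x k) = f (x i) + \sum_(k < n.+2 | k != i) f (x k).
  by rewrite (bigD1 i).
have /andP[f1 f2] : - B <= f (x i) <= B by rewrite -ler_norml.
have /andP[F1 F2] : - B <= F <= B by rewrite -ler_norml.
move: T1 T2 T3 T4; rewrite /tilted_energy Sx -[n.+2%:R]natr1 /=.
move: (\sum_(k < n.+2 | k != i) f (x k)) (\sum_(k < n.+2) f (y k)) (discrete_energy x) (discrete_energy y).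
move: (n.+1%:R : R) m0 m1 (f (x i)) f1 f2 h2 h3 => m m0 m1 fx f1 f2 h2 h3 S Sy DEx DEy T1 T2 T3 T4.
have am : 0 < a * m by rewrite mulr_gt0//; exact: lt_le_trans m1.
have amB : a * m * - B <= a * m * F by rewrite ler_pM2l.
have amf : a * m * fx <= a * m * B by rewrite ler_pM2l.
have e1 : (m + 1) * m * eps <= (m + 1) * m * (a * e / 4) by rewrite ler_wpM2l// mulr_ge0// addr_ge0.
have e2 : (m + 1) * m * (a * e / 4) <= (m + m) * m * (a * e / 4).
  by rewrite ler_wpM2r ?(ltW ae0)// ler_wpM2r// lerD2l.
have e3 : m * (9 + 4 * a * B) <= m * (m * (a * e)) by rewrite ler_wpM2l.
rewrite -(ler_pM2l am); lra.
Qed.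

End near_minimizers.

(** * Norms of products *)

Section sup_norms.
Context {R : realType}.
Variable E : set (Cplane R).
Hypothesis cE : compact E.
Hypothesis E0 : E !=set0.

Lemma horner_locally_lipschitz (p : {poly R[i]}) (z : R[i]) : exists2 C : R, 0 <= C &
  forall w : R[i], cmod (w - z) <= 1 -> cmod (p.[w] - p.[z]) <= C * cmod (w - z).
Proof.
have : root (p - p.[z]%:P) z by rewrite rootE !hornerE subrr.
move=> /factor_theorem[r pr].
exists (\sum_(i < size r) cmod r`_i * (cmod z + 1) ^+ i).
  by apply: sumr_ge0 => i _; rewrite mulr_ge0 ?exprn_ge0 ?addr_ge0 ?cmod_ge0.
move=> w wz; have -> : p.[w] - p.[z] = r.[w] * (w - z).
  by have := congr1 (fun q => q.[w]) pr; rewrite !hornerE.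
rewrite cmodM ler_wpM2r ?cmod_ge0// horner_coef (le_trans (cmod_sum _ _ _))//.
apply: ler_sum => i _; rewrite cmodM cmodX ler_wpM2l ?cmod_ge0//.
rewrite lerXn2r ?nnegrE ?addr_ge0 ?cmod_ge0//.
have := cmod_triangle z w 0; rewrite !subr0; lra.
Qed.

Lemma poly_max (p : {poly R[i]}) :
  exists2 z, E z & forall w, E w -> cmod p.[w] <= cmod p.[z].
Proof.
apply: (compact_max cE E0) => z e e0.
have [C C0 hC] := horner_locally_lipschitz p z.
have C1 : 0 < C + 1 by rewrite ltr_wpDl.
exists (Num.min 1 (e / (C + 1))); first by rewrite lt_min ltr01 divr_gt0.
move=> w; rewrite lt_min => /andP[w1]; rewrite ltr_pdivlMr// => wz.
have h := hC w (ltW w1); have h0 := cmod_ge0 (w - z).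
have : cmod (p.[w] - p.[z]) < e by move: h wz h0; move: (cmod (w - z)) => x; nra.
apply: le_lt_trans; rewrite ler_norml.
have := cmod_triangle p.[z] p.[w] 0; have := cmod_triangle p.[w] p.[z] 0.
rewrite !subr0 (cmodB p.[z] p.[w]) => h1 h2; apply/andP; split; lra.
Qed.

Lemma sup_normP (p : {poly R[i]}) : exists2 z, E z &
  sup_norm E (fun z => p.[z]) = cmod p.[z] /\ forall w, E w -> cmod p.[w] <= cmod p.[z].
Proof.
have [z Ez hz] := poly_max p; exists z => //; split=> //.
apply/le_anti/andP; split.
  apply: ge_sup; first by exists (cmod p.[z]); exists z.
  by move=> _ [w Ew <-]; exact: hz.
apply: ub_le_sup; last by exists z.
by exists (cmod p.[z]) => _ [w Ew <-]; exact: hz.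
Qed.

Variable D : R.
Hypothesis ED : forall z t, E z -> E t -> cmod (z - t) <= D.

Lemma farthest_dist_ub z t : E t -> cmod (z - t) <= farthest_dist E z.
Proof.
move=> Et; apply: ub_le_sup; last by exists t.
exists (cmod (z - t) + D) => _ [u Eu <-].
by rewrite (le_trans (cmod_triangle t _ _))// lerD2l ED.
Qed.

Lemma farthest_dist_le z c : (forall t, E t -> cmod (z - t) <= c) -> farthest_dist E z <= c.
Proof.
move=> h; apply: ge_sup; last by move=> _ [t Et <-]; exact: h.
by have [t Et] := E0; exists (cmod (z - t)); exists t.
Qed.

Lemma farthest_dist_lipschitz z w :
  `|farthest_dist E z - farthest_dist E w| <= cmod (z - w).
Proof.
have h x y : farthest_dist E x <= cmod (x - y) + farthest_dist E y.
  apply: farthest_dist_le => t Et; rewrite (le_trans (cmod_triangle y _ _))// lerD2l.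
  exact: farthest_dist_ub.
by rewrite ler_norml; have := h z w; have := h w z; rewrite (cmodB w z) => h1 h2; apply/andP; split; lra.
Qed.

Lemma farthest_dist_lower p q z : E p -> E q -> cmod (p - q) / 2 <= farthest_dist E z.
Proof.
move=> Ep Eq; have := farthest_dist_ub z Ep; have := farthest_dist_ub z Eq.
have := cmod_triangle z p q; rewrite (cmodB p z); lra.
Qed.

End sup_norms.

(** * Upper bound: the inequality holds with the claimed constant *)

Section product_bounds.
Context {R : realType}.
Variables (E : set (Cplane R)) (D d v F : R).
Hypothesis cE : compact E.
Hypothesis E0 : E !=set0.
Hypothesis ED : forall z t, E z -> E t -> cmod (z - t) <= D.
Hypothesis d0 : 0 < d.
Hypothesis dE : forall z, E z -> d <= farthest_dist E z.

Let dE0 z : E z -> 0 < farthest_dist E z.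
Proof. by move/dE; exact: lt_le_trans. Qed.

Lemma expR_sum (I : Type) (r : seq I) (P : pred I) (g : I -> R) :
  expR (\sum_(i <- r | P i) g i) = \prod_(i <- r | P i) expR (g i).
Proof. by rewrite (big_morph expR (@expRD R) (@expR0 R)). Qed.

Lemma prod_pos_ge (I : finType) (P : pred I) (g : I -> R) (c : R) :
  (forall i, P i -> 0 < g i) -> \sum_(i | P i) - ln (g i) <= c ->
  expR (- c) <= \prod_(i | P i) g i.
Proof.
move=> g0; rewrite sumrN lerNl => h.
rewrite (eq_bigr (fun i => expR (ln (g i)))) => [|i Pi]; last by rewrite lnK// posrE g0.
by rewrite -expR_sum ler_expR.
Qed.

Lemma le_expR_limit (A X k : R) : 0 <= X -> 0 < k ->
  (forall e, 0 < e -> A <= X * expR (k * e)) -> A <= X.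
Proof.
move=> X0 k0 h; apply/ler_addgt0Pr => u u0.
have X1 : 0 < X + 1 by rewrite ltr_wpDl.
have q0 : 0 < u / (X + 1) by rewrite divr_gt0.
have q1 : 0 < 1 + u / (X + 1) by rewrite addr_gt0.
have l0 : 0 < ln (1 + u / (X + 1)) / k by rewrite divr_gt0// ln_gt0// ltrDl.
apply: (le_trans (h _ l0)); rewrite mulrCA divff ?gt_eqF// mulr1 lnK ?posrE//.
rewrite mulrDr mulr1 lerD2l mulrA ler_pdivrMr// mulrC ler_pM2l//; lra.
Qed.

Hypothesis points : forall e : R, 0 < e -> exists N : nat, forall n, (N <= n)%N ->
  exists x : 'I_n -> Cplane R, [/\ injective x, (forall i, E (x i)),
    (forall i, \sum_(k < n | k != i) - ln (cmod (x i - x k)) <= n.-1%:R * (v + e)) &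
    \sum_(i < n) ln (farthest_dist E (x i)) <= n%:R * (F + e)].

Lemma prod_dist_bound_limit n m (z : 'I_n.+1 -> R[i]) (t : nat -> R[i])
    (kap : 'I_n.+1 -> nat) (S : R) :
  (forall j, (kap j < m)%N /\ z j != t (kap j)) ->
  (forall k, (k < m)%N -> E (t k)) ->
  (forall w, E w -> cmod (\prod_(j < n.+1) (w - z j)) <= S) ->
  \prod_(j < n.+1) cmod (z j - t (kap j)) <= S * expR (n.+1%:R * (v + F)).
Proof.
move=> hz tE hS.
have S0 : 0 <= S by have [w Ew] := E0; apply: le_trans (hS w Ew); exact: cmod_ge0.
set A := \prod_(j < n.+1) _.
have A0 : 0 <= A by apply: prodr_ge0 => j _; exact: cmod_ge0.
have step e : 0 < e -> A <= S * expR (n.+1%:R * (v + F)) * expR ((3 * n.+1%:R + 1) * e).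
  move=> e0; have [N hN] := points e0.
  (* As [d] bounds d_E from below on E, d_E + r <= d_E (1 + e) there, so the radius costs only a
     factor exp(e) per node. *)
  pose r := d * e; have r0 : 0 < r by rewrite mulr_gt0.
  apply: (@le_of_geometric _ _ _ 1 (r^-1 * expR (F + 2 * e) * (n.+1%:R / e + 1)) N) => //.
    by rewrite !mulr_ge0 ?expR_ge0.
  move=> l Nl; rewrite mul1r; set N' := (n.+1 * l)%N.
  have [|x [xi xE xv xF]] := hN N'.+1.
    by rewrite /N' leqW// (leq_trans Nl)// leq_pmull.
  have pd : 0 < expR (- (N'%:R * (v + e))) by exact: expR_gt0.
  have := @prod_dist_bound R n l m z t kap x (fun i => farthest_dist E (x i)) S _ r hz xi r0 pd
    (fun i => hS _ (xE i)) _ (fun i k km => farthest_dist_ub ED (x i) (tE k km)).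
  rewrite -/A -/N' => hA; apply: (le_trans (hA _)) => [i|{hA}].
    apply: prod_pos_ge => [k ki|]; last exact: xv.
    by rewrite lt0r cmod_ge0 andbT cmod_eq0 subr_eq0 (inj_eq xi) eq_sym.
  have hprod : \prod_i (farthest_dist E (x i) + r) <= expR (N'.+1%:R * (F + 2 * e)).
    apply: (@le_trans _ _ (expR (\sum_i (ln (farthest_dist E (x i)) + e)))).
      rewrite expR_sum; apply: ler_prod => i _.
      rewrite addr_ge0 ?(ltW (dE0 _)) ?(ltW r0)//= expRD lnK ?posrE ?dE0//.
      apply: (@le_trans _ _ (farthest_dist E (x i) * (1 + e))).
        by rewrite mulrDr mulr1 lerD2l ler_wpM2r ?dE// ltW.
      by rewrite ler_wpM2l ?expR_ge1Dx// ltW// dE0.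
    rewrite ler_expR big_split/= sumr_const card_ord -[e *+ _]mulr_natl.
    by move: xF; move: (\sum_(i < _) _) (N'.+1%:R : R) => s k; lra.
  have hN' : N'.+1%:R <= (n.+1%:R / e + 1) * expR (e * l%:R).
    have h1 := expR_ge1Dx (e * l%:R).
    have h2 : 1 <= expR (e * l%:R) by rewrite -expR0 ler_expR mulr_ge0 ?(ltW e0).
    have h3 : l%:R <= expR (e * l%:R) / e by rewrite ler_pdivlMr// mulrC; move: h1; lra.
    rewrite /N' -natr1 natrM mulrDl mul1r; apply: lerD => //.
    by rewrite mulrAC -mulrA ler_wpM2l.
  rewrite invfM -expRN opprK.
  have -> : r^-1 * expR (F + 2 * e) * (n.+1%:R / e + 1) *
      (S * expR (n.+1%:R * (v + F)) * expR ((3 * n.+1%:R + 1) * e)) ^+ l =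
      S ^+ l * r^-1 * (((n.+1%:R / e + 1) * expR (e * l%:R)) * expR (N'%:R * (v + e)) *
        expR (N'.+1%:R * (F + 2 * e))).
    (* Error exponents per unit of l: (n+1) e from the node separation, 2 (n+1) e from the
       distances, e from the factor N'+1. The node in excess of the degree accounts for
       [expR (F + 2 * e)]. *)
    have hexp : expR (F + 2 * e) * (expR (n.+1%:R * (v + F)) ^+ l *
        expR ((3 * n.+1%:R + 1) * e) ^+ l) =
        expR (e * l%:R) * expR (N'%:R * (v + e)) * expR (N'.+1%:R * (F + 2 * e)).
      rewrite -!expRM_natl -!expRD; congr expR.
      by rewrite /N' -[(_ * l).+1%:R]natr1 natrM; ring.
    rewrite !exprMn -mulrA; transitivity (S ^+ l * r^-1 * ((n.+1%:R / e + 1) *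
      (expR (F + 2 * e) * (expR (n.+1%:R * (v + F)) ^+ l * expR ((3 * n.+1%:R + 1) * e) ^+ l)))).
      by ring.
    by rewrite hexp; ring.
  have -> : S ^+ l * (N'.+1%:R * (expR (N'%:R * (v + e)) * r^-1)) *
      \prod_i (farthest_dist E (x i) + r) =
      S ^+ l * r^-1 * (N'.+1%:R * expR (N'%:R * (v + e)) * \prod_i (farthest_dist E (x i) + r)).
    by ring.
  rewrite ler_wpM2l ?mulr_ge0 ?exprn_ge0 ?invr_ge0 ?(ltW r0)//.
  apply: ler_pM => //.
  - by apply: prodr_ge0 => i _; rewrite addr_ge0 ?(ltW (dE0 _)) ?(ltW r0).
  - by rewrite ler_wpM2r ?expR_ge0.
have k0 : 0 < 3 * n.+1%:R + 1 :> R by rewrite ltr_wpDl// mulr_ge0.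
by apply: (le_expR_limit _ k0) => //; rewrite mulr_ge0 ?expR_ge0.
Qed.

Lemma product_inequality_holds : product_inequality E (expR (F + v)).
Proof.
move=> m p m0 /=; set q := \prod_(k < m) p k.
have supE (g : {poly R[i]}) := sup_normP cE E0 g.
have [[k pk]|pn0] := pselect (exists k, p k = 0).
  have q0 : q = 0 by rewrite /q (bigD1 k)//= pk mul0r.
  rewrite (bigD1 k)//= pk q0 size_poly0 expr0 mul1r.
  have [z Ez [-> _]] := supE 0; have -> : cmod (0 : {poly R[i]}).[z] = 0.
    by rewrite horner0 cmod0.
  by rewrite mul0r.
have {}pn0 k : p k != 0 by apply/eqP => pk; apply: pn0; exists k.
have attained k : exists z, E z /\ sup_norm E (fun z => (p k).[z]) = cmod (p k).[z] /\
    forall w, E w -> cmod (p k).[w] <= cmod (p k).[z].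
  by have [z Ez hz] := supE (p k); exists z.
have [t tP] := choice attained.
pose rs k := sval (closed_field_poly_normal (p k)).
have prs k : p k = lead_coef (p k) *: \prod_(z <- rs k) ('X - z%:P).
  exact: (svalP (closed_field_poly_normal (p k))).
pose tn (k : nat) : R[i] := if insub k is Some k' then t k' else 0.
have tnE (k : 'I_m) : tn k = t k by rewrite /tn valK.
pose s := [seq (z, val k) | k <- enum 'I_m, z <- rs k].
pose c := \prod_(k < m) cmod (lead_coef (p k)).
have c0 : 0 < c.
  by apply: prodr_gt0 => k _; rewrite lt0r cmod_ge0 andbT cmod_eq0 lead_coef_eq0.
have hp k w : cmod (p k).[w] = cmod (lead_coef (p k)) * \prod_(z <- rs k) cmod (w - z).
  rewrite {1}prs hornerZ cmodM horner_prod cmod_prod; congr (_ * _).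
  by apply: eq_bigr => z _; rewrite !hornerE.
have lhsE : \prod_(k < m) sup_norm E (fun z => (p k).[z]) =
    c * \prod_(u <- s) cmod (u.1 - tn u.2).
  rewrite /s big_allpairs_dep/= big_enum/= -big_split/=; apply: eq_bigr => k _.
  rewrite (tP k).2.1 hp; congr (_ * _); apply: eq_bigr => z _.
  by rewrite tnE cmodB.
have qE w : cmod q.[w] = c * \prod_(u <- s) cmod (w - u.1).
  rewrite /q horner_prod cmod_prod /s big_allpairs_dep/= big_enum/= -big_split/=.
  by apply: eq_bigr => k _; rewrite hp.
have sq : (size q).-1 = size s.
  have -> : q = (\prod_(k < m) lead_coef (p k)) *: \prod_(u <- s) ('X - u.1%:P).
    rewrite /q /s big_allpairs_dep/= big_enum/= -scaler_prod.
    by apply: eq_bigr => k _; exact: prs.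
  rewrite size_scale ?size_prod_XsubC//.
  by apply/prodf_neq0 => k _; rewrite lead_coef_eq0.
have [zq Ezq [-> hq]] := supE q.
(* If |p_k| vanished at its maximum point, p_k would vanish on E, which contains more distinct
   points than the degree of p_k. *)
have svalid u : u \in s -> (u.2 < m)%N /\ u.1 != tn u.2.
  move=> /allpairsPdep[k [z [_ zk ->]]] /=; split; first exact: ltn_ord.
  rewrite tnE; apply/eqP => zt.
  have pt0 : cmod (p k).[t k] = 0.
    by rewrite hp (big_rem z)//= zt subrr cmod0 mul0r mulr0.
  have [N hN] := points ltr01.
  have [x [xi xE _ _]] := hN _ (leq_maxl N (size (p k))).
  have := @max_poly_roots _ (p k) [seq x i | i <- enum 'I__] (pn0 k).
  rewrite map_inj_uniq// enum_uniq size_map size_enum_ord ltnNge leq_maxr.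
  move=> h; have : false by apply: h => //; apply/allP => _ /mapP[i _ ->];
    rewrite rootE -cmod_eq0 eq_le cmod_ge0 andbT -pt0; exact: (tP k).2.2.
  by [].
rewrite lhsE sq qE.
have [n sn] : exists n, size s = n by exists (size s).
(* Without roots all factors are constant and both sides agree. *)
case: n sn => [|n] sn.
  by rewrite (size0nil sn) !big_nil expr0 mul1r.
pose z (j : 'I_n.+1) := (nth (0, 0%N) s j).1.
pose kap (j : 'I_n.+1) := (nth (0, 0%N) s j).2.
have sprod (g : R[i] * nat -> R) : \prod_(u <- s) g u = \prod_(j < n.+1) g (nth (0, 0%N) s j).
  by rewrite (big_nth (0, 0%N)) big_mkord sn.
rewrite mulrCA ler_pM2l// sn -expRM_natl (addrC F) mulrC.
rewrite sprod.
apply: (@prod_dist_bound_limit n m z tn kap).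
- by move=> j; apply: svalid; rewrite mem_nth// sn.
- by move=> k km; rewrite -[k]/(val (Ordinal km)) tnE; exact: (tP _).1.
- move=> w Ew; rewrite -(ler_pM2l c0) -qE.
  have := hq w Ew; rewrite {1}qE.
  by rewrite cmod_prod sprod.
Qed.

End product_bounds.

(** * Lower bound: linear factors with extremal roots *)

Section sharpness.
Context {R : realType}.
Variables (E : set (Cplane R)) (v F : R).
Hypothesis cE : compact E.
Hypothesis E0 : E !=set0.
Hypothesis dE0 : forall z, E z -> 0 < farthest_dist E z.

Lemma sup_norm_XsubC (x : R[i]) :
  sup_norm E (fun z => ('X - x%:P).[z]) = farthest_dist E x.
Proof.
rewrite /sup_norm /farthest_dist; congr sup; apply/seteqP; split=> _ [z Ez <-];
  by exists z; rewrite // !hornerE cmodB.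
Qed.

Hypothesis extremal : forall e : R, 0 < e ->
  exists n (x : 'I_n.+2 -> Cplane R) (i : 'I_n.+2), [/\ forall k, E (x k),
    forall z, E z -> (forall k, k != i -> z != x k) ->
      n.+1%:R * (v - e) <= \sum_(k < n.+2 | k != i) - ln (cmod (z - x k)) &
    n.+1%:R * (F - e) <= \sum_(k < n.+2 | k != i) ln (farthest_dist E (x k))].

Lemma product_inequality_sharp (y : R) : 0 < y -> product_inequality E y ->
  expR (F + v) <= y.
Proof.
move=> y0 hy; apply: (@le_expR_limit _ _ _ 2) => //; first exact: ltW.
move=> e e0; have [n [x [i [xE hz hF]]]] := extremal e0.
pose p (k : 'I_n.+1) : {poly R[i]} := 'X - (x (lift i k))%:P.
have lifted (g : 'I_n.+2 -> R) :
    \sum_(k < n.+2 | k != i) g k = \sum_(k < n.+1) g (lift i k).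
  apply: (@addrI _ (g i)); transitivity (\sum_k g k).
    by rewrite [RHS](bigD1 i).
  by rewrite (bigD1_ord i).
have sq : size (\prod_(k < n.+1) p k) = n.+2.
  by rewrite -big_enum/= size_prod_XsubC size_enum_ord.
have := hy n.+1 p isT; rewrite /= sq.
rewrite (eq_bigr (fun k => farthest_dist E (x (lift i k)))) => [|k _]; last first.
  exact: sup_norm_XsubC.
have [z Ez [-> _]] := sup_normP cE E0 (\prod_(k < n.+1) p k).
have hq : cmod (\prod_(k < n.+1) p k).[z] <= expR (- (n.+1%:R * (v - e))).
  rewrite horner_prod cmod_prod.
  (* [extremal] gives no information at a root, but there the product vanishes. *)
  have [[k zk]|zx] := pselect (exists k, z = x (lift i k)).
    by rewrite (bigD1 k)//= zk !hornerE subrr cmod0 mul0r expR_ge0.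
  have zl k : 0 < cmod (z - x (lift i k)).
    rewrite lt0r cmod_ge0 andbT cmod_eq0 subr_eq0; apply/eqP => h; apply: zx; by exists k.
  rewrite (eq_bigr (fun k => expR (ln (cmod (z - x (lift i k)))))) => [|k _]; last first.
    by rewrite lnK ?posrE// !hornerE.
  rewrite -expR_sum ler_expR lerNr -sumrN -(lifted (fun k => - ln (cmod (z - x k)))).
  apply: hz => // k ki; apply/eqP => zk; apply: zx.
  by move: ki; rewrite eq_sym => /unlift_some[j kj _]; exists j; rewrite -kj.
have hd : expR (n.+1%:R * (F - e)) <= \prod_(k < n.+1) farthest_dist E (x (lift i k)).
  rewrite (eq_bigr (fun k => expR (ln (farthest_dist E (x (lift i k)))))) => [|k _].
    by rewrite -expR_sum ler_expR -(lifted (fun k => ln (farthest_dist E (x k)))).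
  by rewrite lnK// posrE dE0.
move=> h; have {h hq hd} : expR (n.+1%:R * (F - e)) <= y ^+ n.+1 * expR (- (n.+1%:R * (v - e))).
  by apply: (le_trans hd); apply: (le_trans h); rewrite ler_wpM2l ?exprn_ge0 ?(ltW y0).
rewrite expRN ler_pdivlMr ?expR_gt0// -expRD -mulrDr expRM_natl.
rewrite ler_pXn2r ?nnegrE// ?expR_ge0 ?(ltW y0)// => h.
have -> : F + v = (F - e + (v - e)) + 2 * e by ring.
by rewrite expRD ler_wpM2r ?expR_ge0.
Qed.

End sharpness.

(** * Assembly of the two bounds *)

Theorem theorem2p1 (R : realType) (E : set (Cplane R)) (hE : compact E)
    (hcap : 0 < log_capacity E)
    (muE : probability (borelC R) R) (hmuE : is_equilibrium_measure E muE) :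
  is_smallest (fun M : R => 0 < M /\ product_inequality E M)
    (expR (\int[muE]_z ln (farthest_dist E z)) / log_capacity E).
Proof.
have [muC muV] := hmuE.
have mE : measurable (E : set (borelC R)) by exact: measurable_compactC.
(* Positive capacity excludes both infinities: for a Robin constant -oo the exponential is +oo,
   which [fine] sends to 0. *)
have [v vE capE] : exists2 v : R, robin_constant E = v%:E & log_capacity E = expR (- v).
  move: hcap; rewrite /log_capacity; case: (robin_constant E) => [r| |] /=.
  - by move=> _; exists r.
  - by rewrite ltxx.
  - by rewrite ltxx.
have [D D1 ED] := compact_diameter hE.
have D0 : 0 < D by exact: lt_le_trans D1.
pose w := v + ln D.
have muw : (\int[muE]_z \int[muE]_t pos_kernel D z t = w%:E)%E.
  by rewrite -(log_energy_shift D1 hE ED muC) muV vE.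
have wmin (nu : probability (borelC R) R) : carried_by E nu ->
    (w%:E <= \int[nu]_z \int[nu]_t pos_kernel D z t)%E.
  move=> nuC; rewrite -(log_energy_shift D1 hE ED nuC) EFinD leeD2r// -vE.
  by apply: ereal_inf_lbound; exists nu.
have avg := averaging_point mE D1 ED muC muw wmin.
pose K := good_set E D w muE.
(* Averaging with zero f still yields points outside [s]. Two distinct points of E then bound d_E
   from below by half their distance. *)
have fresh (s : seq (Cplane R)) : (forall x, x \in s -> K x) ->
    exists2 z, K z & z \notin s.
  move=> sK; have z0 (z : Cplane R) : `|0 : R| <= 0 by rewrite normr0.
  by have [z [Kz zs _]] := avg (fun=> 0) 0 0 s (measurable_cst _) z0 sK; exists z.
have [p Kp _] : exists2 p, K p & p \notin [::] by exact: fresh.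
have [q Kq qp] : exists2 q, K q & q \notin [:: p].
  by apply: fresh => x; rewrite inE => /eqP->.
have Ep : E p by exact: Kp.1.
have Eq : E q by exact: Kq.1.
have {}qp : q != p by rewrite inE in qp.
have E0 : E !=set0 by exists p.
pose d := cmod (p - q) / 2.
have d0 : 0 < d.
  by rewrite divr_gt0// lt0r cmod_ge0 andbT cmod_eq0 subr_eq0 eq_sym.
have dD : d <= D by have := ED _ _ Ep Eq; rewrite /d; have := cmod_ge0 (p - q); lra.
have dE z : d <= farthest_dist E z by exact: (farthest_dist_lower ED z Ep Eq).
have ED' z : E z -> farthest_dist E z <= D by move=> Ez; apply: farthest_dist_le => // t; exact: ED.
(* Agrees with log d_E on E, but is bounded and Lipschitz on the whole plane. *)
pose f z := ln (Num.min D (Num.max d (farthest_dist E z))).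
have fE z : E z -> f z = ln (farthest_dist E z).
  by move=> Ez; rewrite /f (max_idPr (dE z)) (min_idPr (ED' z Ez)).
have fd z : d <= Num.min D (Num.max d (farthest_dist E z)) by rewrite le_min dD le_max lexx.
have fD z : Num.min D (Num.max d (farthest_dist E z)) <= D by rewrite ge_min lexx.
have flip z z' : `|f z - f z'| <= d^-1 * cmod (z - z').
  rewrite (le_trans (ler_ln_dist d0 (fd z) (fd z')))// mulrC ler_pM2l ?invr_gt0//.
  exact: le_trans (clip_dist _ _ _ _) (farthest_dist_lipschitz E0 ED z z').
have mf : measurable_fun setT (f : borelC R -> R) by exact: lipschitz_measurable flip.
pose B := `|ln d| + `|ln D|.
have fB z : `|f z| <= B.
  have h1 : ln d <= f z by rewrite ler_ln ?posrE// (lt_le_trans d0).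
  have h2 : f z <= ln D by rewrite ler_ln ?posrE// (lt_le_trans d0).
  have := ler_norm (ln D); have := ler_norm (- ln d); rewrite normrN.
  have := normr_ge0 (ln D); have := normr_ge0 (ln d).
  by rewrite ler_norml /B => *; apply/andP; split; lra.
pose F := \int[muE]_z f z.
have FE : \int[muE]_z ln (farthest_dist E z) = F.
  congr fine; apply: ae_eq_integral => //.
  - apply/measurable_EFinP/(measurableT_comp (@measurable_ln R)).
    by apply: (@lipschitz_measurable _ 1) => z z'; rewrite mul1r; exact: (farthest_dist_lipschitz E0 ED).
  - exact/measurable_EFinP.
  - exists (~` E); split; [exact: measurableC|exact: muC|].
    by move=> z /= h Ez; apply: h => _; rewrite fE.
have FB : `|F| <= B.
  have fi : muE.-integrable setT (EFin \o (f : borelC R -> R)).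
    apply: measurable_bounded_integrable => //.
      by rewrite /= probability_setT ltry.
    exists B; split; first exact: num_real.
    by move=> x Bx z _ /=; rewrite (le_trans (fB z))// ltW.
  apply: (le_trans (le_normr_Rintegral _ fi)) => //.
  have -> : B = \int[muE]_z B by rewrite Rintegral_cst//= probability_setT mulr1.
  apply: le_Rintegral => //; first exact: integrable_abse fi.
  exact: finite_measure_integrable_cst.
have energy (e : R) : 0 < e -> exists N : nat, forall n (x : 'I_n -> Cplane R),
    (N <= n)%N -> injective x -> (forall i, E (x i)) ->
    n%:R * n.-1%:R * (v - e) <= discrete_energy x.
  move=> e0; apply: (discrete_energy_lower_bound hE ED _ e0) => nu nuC r r0.
  apply: clip_energy_gt => //; apply: lt_le_trans (wmin nu nuC).
  by rewrite lte_fin /w ltrBlDr ltrDl.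
have averaging (a : R) (s : seq (Cplane R)) : (forall x, x \in s -> K x) ->
    exists z, [/\ K z, z \notin s &
      \sum_(x <- s) - ln (cmod (z - x)) + a * f z <= (size s)%:R * v + a * F + 1].
  move=> sK; have [z [Kz zs hz]] := avg f B a s mf fB sK.
  by exists z; split=> //; move: hz; rewrite /w addrK.
have KE : K `<=` E by move=> z [].
rewrite FE capE -expRN opprK -expRD; split; first split.
- exact: expR_gt0.
- apply: (@product_inequality_holds R E D d v F) => // e e0.
  have [N hN] := equidistributed_points KE ED fB FB energy averaging e0.
  exists N => n /hN[x [xi xE xv xF]]; exists x; split=> //.
  by under eq_bigr do rewrite -fE//.
- move=> y [y0 hy]; apply: (@product_inequality_sharp R E v F) => // [z _|e e0].
    exact: lt_le_trans (dE z).
  have [n [x [i [xE hx hF]]]] := extremal_points KE ED fB FB energy averaging e0.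
  exists n, x, i; split=> //.
  by under eq_bigr do rewrite -fE//.
Qed.
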